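(* Let $W=W_{D_n}$ ($n\ge4$) or $W=W_{B_n}$ ($n\ge2$). Let $\mathfrak{H}^{\mathfrak c}_W$ and $\mathfrak{H}^-_W$ be the degenerate affine Hecke-Clifford algebra and the degenerate spin affine Hecke algebra of the corresponding type (with the same parameter $u\in\mathbb{C}$ in type $D_n$, and the same parameters $u,v\in\mathbb{C}$ in type $B_n$). Then: (1) there exists an isomorphism of superalgebras $\Phi:\mathfrak{H}^{\mathfrak c}_W\longrightarrow\mathcal{C}_n\otimes\mathfrak{H}^-_W$ which is the identity on $\mathcal{C}_n$, sends $s_i\mapsto-\sqrt{-1}\,\beta_it_i$ and $x_i\mapsto\sqrt{-2}\,c_ib_i$ for each $1\le i\le n$; (2) the inverse $\Psi:\mathcal{C}_n\otimes\mathfrak{H}^-_W\longrightarrow\mathfrak{H}^{\mathfrak c}_W$ is the identity on $\mathcal{C}_n$, and sends $t_i\mapsto\sqrt{-1}\,\beta_is_i$ and $b_i\mapsto\frac{1}{\sqrt{-2}}c_ix_i$ for each $1\le i\le n$.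
   Context: All algebras are unital associative over $\mathbb{C}$; $\sqrt{-1}$ is fixed and $\sqrt{-2}=\sqrt2\sqrt{-1}$. For superalgebras, $\mathcal A\otimes\mathcal B$ has product $(a\otimes b)(a'\otimes b')=(-1)^{|b||a'|}aa'\otimes bb'$; $ab$ abbreviates $a\otimes b$. $\mathcal{C}_n$ is the Clifford algebra generated by odd elements $c_1,\dots,c_n$ with $c_i^2=1$, $c_ic_j=-c_jc_i$ ($i\ne j$). Put $\beta_i=\frac1{\sqrt2}(c_i-c_{i+1})$ for $1\le i\le n-1$; $\beta_n=\frac1{\sqrt2}(c_{n-1}+c_n)$ in type $D_n$; $\beta_n=c_n$ in type $B_n$. Both Weyl groups are generated by $s_1,\dots,s_n$ with $s_i^2=1$, where $s_1,\dots,s_{n-1}$ satisfy the Coxeter relations of $S_n$ with $s_i=(i,i+1)$. In $W_{D_n}$ additionally $s_is_n=s_ns_i$ ($i\ne n-2$), $s_{n-2}s_ns_{n-2}=s_ns_{n-2}s_n$. In $W_{B_n}$ additionally $s_is_n=s_ns_i$ ($i\le n-2$), $(s_{n-1}s_n)^4=1$. $\mathfrak{H}^{\mathfrak c}_W$ is generated by $x_i,c_i,s_i$ ($1\le i\le n$) subject to the relations of $W$ for the $s_i$, of $\mathcal{C}_n$ for the $c_i$, and: $x_ix_j=x_jx_i$; $x_ic_i=-c_ix_i$, $x_ic_j=c_jx_i$ ($i\ne j$); $\sigma c_i=c_{\sigma(i)}\sigma$ for $\sigma\in S_n=\langle s_1,\dots,s_{n-1}\rangle$; for $1\le i\le n-1$,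 $x_{i+1}s_i-s_ix_i=u(1-c_{i+1}c_i)$ and $x_js_i=s_ix_j$ ($j\neq i,i+1$); together with, in type $D_n$: $s_nc_n=-c_{n-1}s_n$, $s_nc_i=c_is_n$ ($i\ne n-1,n$), $s_nx_n+x_{n-1}s_n=-u(1+c_{n-1}c_n)$, $s_nx_i=x_is_n$ ($i\neq n-1,n$); in type $B_n$: $s_nc_n=-c_ns_n$, $s_nc_i=c_is_n$ ($i\ne n$), $s_nx_n+x_ns_n=-\sqrt2\,v$, $s_nx_i=x_is_n$ ($i\ne n$). It is a superalgebra with $x_i,s_i$ even, $c_i$ odd. $\mathfrak{H}^-_W$ is generated by $b_1,\dots,b_n,t_1,\dots,t_n$ (all odd) subject to: $t_i^2=1$; $t_it_{i+1}t_i=t_{i+1}t_it_{i+1}$ ($1\le i\le n-2$); $t_it_j=-t_jt_i$ ($|i-j|>1$, $i,j\le n-1$); in type $D_n$: $t_it_n=-t_nt_i$ ($i\neq n-2,n$), $t_{n-2}t_nt_{n-2}=t_nt_{n-2}t_n$; in type $B_n$: $t_it_n=-t_nt_i$ ($i\le n-2$), $(t_{n-1}t_n)^4=-1$; $b_ib_j=-b_jb_i$ ($i\neq j$); for $1\le i\le n-1$: $t_ib_i+b_{i+1}t_i=u$ and $t_ib_j=-b_jt_i$ ($j\neq i,i+1$); in type $D_n$: $t_nb_n+b_{n-1}t_n=u$, $t_nb_i=-b_it_n$ ($i\ne n-1,n$); in type $B_n$: $t_nb_n+b_nt_n=v$, $t_nb_i=-b_it_n$ ($i\neq n$). *)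

(* Defs.v *)
From HB Require Import structures.
From mathcomp Require Import all_boot all_order all_algebra perm.
From mathcomp Require Export boolp reals.
From mathcomp.real_closed Require Export complex.
Set Implicit Arguments.
Unset Strict Implicit.
Unset Printing Implicit Defensive.
Import GRing.Theory Num.Theory.
Local Open Scope ring_scope.
Local Open Scope quotient_scope.

Reserved Notation "k %:S" (at level 2, left associativity, format "k %:S").
Reserved Notation "a ⊗ b" (at level 40, left associativity).

(* A unital associative K-algebra is given as a ring A with a central scalar
   map K -> A (MathComp's [algType] would force 1 != 0, which is not part of
   the data of an algebra given by generators and relations).  [hpart d a] is
   the component of [a] of parity [d]; [true] means odd. *)
HB.mixin Record isSuperalgebra (K : comNzRingType) A of GRing.PzRing A := {
  scal : K -> A;
  scal1 : scal 1 = 1;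
  scalD : {morph scal : k l / k + l};
  scalM : {morph scal : k l / k * l};
  scalC : forall k a, scal k * a = a * scal k;
  hpart : bool -> A -> A;
  hpartD : forall d, {morph hpart d : a b / a + b};
  hpartZ : forall d k a, hpart d (scal k * a) = scal k * hpart d a;
  hpart_sum : forall a, hpart false a + hpart true a = a;
  hpart_hpart : forall d e a,
    hpart d (hpart e a) = if d == e then hpart e a else 0;
  hpart_mul : forall d e a b,
    hpart (d (+) e) (hpart d a * hpart e b) = hpart d a * hpart e b
}.
#[short(type="superalgType")]
HB.structure Definition Superalgebra (K : comNzRingType) :=
  {A of GRing.PzRing A & isSuperalgebra K A}.

Notation "k %:S" := (scal k) : ring_scope.

Section SuperalgebraTheory.
Context {K : comNzRingType}.
Implicit Types A B : superalgType K.

Definition homogeneous A (d : bool) (a : A) : Prop := hpart d a = a.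

Definition superalg_morphism A B (f : A -> B) : Prop :=
  [/\ forall a b, f (a + b) = f a + f b,
      forall a b, f (a * b) = f a * f b,
      forall k : K, f k%:S = k%:S &
      forall d a, homogeneous d a -> homogeneous d (f a)].

Definition superalg_isomorphism A B (f : A -> B) : Prop :=
  superalg_morphism f /\ bijective f.

Lemma scal0 A : 0%:S = 0 :> A.
Proof. by apply: (addrI (0%:S : A)); rewrite -scalD !addr0. Qed.

Lemma scalN A (k : K) : (- k)%:S = - k%:S :> A.
Proof. by apply: (addrI (k%:S : A)); rewrite -scalD !subrr scal0. Qed.

Lemma hpart0 A d : hpart d (0 : A) = 0.
Proof. by apply: (addrI (hpart d (0 : A))); rewrite -hpartD !addr0. Qed.

Lemma hpart_homog A d (a : A) : homogeneous d (hpart d a).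
Proof. by rewrite /homogeneous hpart_hpart eqxx. Qed.

Lemma homogeneousE A d e (a : A) :
  homogeneous e a -> hpart d a = if d == e then a else 0.
Proof. by move=> ha; rewrite -[in LHS]ha hpart_hpart ha. Qed.

Lemma homogM A d e (a b : A) :
  homogeneous d a -> homogeneous e b -> homogeneous (d (+) e) (a * b).
Proof. by move=> ha hb; rewrite /homogeneous -ha -hb hpart_mul. Qed.

Lemma homogD A d (a b : A) :
  homogeneous d a -> homogeneous d b -> homogeneous d (a + b).
Proof. by move=> ha hb; rewrite /homogeneous hpartD ha hb. Qed.

Lemma hpart1 A d : hpart d (1 : A) = if d then 0 else 1.
Proof.
have o0 : hpart true (1 : A) = 0.
  set o := hpart true 1.
  have homo_o : homogeneous true o by exact: hpart_homog.
  have kill e (a : A) : homogeneous e a -> a * o = 0.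
    move=> ha; have : a = a * hpart false 1 + a * o.
      by rewrite -mulrDr hpart_sum mulr1.
    move=> /(congr1 (hpart (e (+) true))).
    rewrite hpartD (homogeneousE _ ha) (homogM ha homo_o).
    have -> : hpart (e (+) true) (a * hpart false 1) = 0.
      by rewrite (homogeneousE _ (homogM ha (hpart_homog _ _))) addbF; case: e {ha}.
    by rewrite add0r => <-; case: e {ha}.
  rewrite -[o]mul1r -(hpart_sum 1) mulrDl.
  by rewrite !(kill _ _ (hpart_homog _ _)) addr0.
by case: d => //; rewrite -[RHS]hpart_sum o0 addr0.
Qed.

Lemma hpart_scal A d (k : K) : hpart d (k%:S : A) = if d then 0 else k%:S.
Proof. by rewrite -[k%:S]mulr1 hpartZ hpart1; case: d; rewrite ?mulr0. Qed.

End SuperalgebraTheory.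

Section Tensor.
Context {K : comNzRingType} (A B : superalgType K).

(* The tensor product over K is the quotient of the formal finite sums of pure
   tensors by the additive congruence generated by bilinearity. *)
Inductive tensor_cong : seq (A * B) -> seq (A * B) -> Prop :=
| TC_refl s : tensor_cong s s
| TC_sym s t : tensor_cong s t -> tensor_cong t s
| TC_trans s t r : tensor_cong s t -> tensor_cong t r -> tensor_cong s r
| TC_add s s' t t' :
    tensor_cong s s' -> tensor_cong t t' -> tensor_cong (s ++ t) (s' ++ t')
| TC_addC s t : tensor_cong (s ++ t) (t ++ s)
| TC_zero b : tensor_cong [:: (0, b)] [::]
| TC_addl a a' b : tensor_cong [:: (a + a', b)] [:: (a, b); (a', b)]
| TC_addr a b b' : tensor_cong [:: (a, b + b')] [:: (a, b); (a, b')]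
| TC_scale (k : K) a b :
    tensor_cong [:: (k%:S * a, b)] [:: (a, k%:S * b)].

Definition tensor_sum := seq (A * B).
HB.instance Definition _ := gen_eqMixin tensor_sum.
HB.instance Definition _ := gen_choiceMixin tensor_sum.

Definition tensor_eq (s t : tensor_sum) : bool := `[< tensor_cong s t >].

Lemma tensor_eq_refl : reflexive tensor_eq.
Proof. by move=> s; apply/asboolP; exact: TC_refl. Qed.
Lemma tensor_eq_sym : symmetric tensor_eq.
Proof. by move=> s t; apply/asboolP/asboolP; exact: TC_sym. Qed.
Lemma tensor_eq_trans : transitive tensor_eq.
Proof.
by move=> s t r /asboolP h1 /asboolP h2; apply/asboolP; exact: TC_trans h1 h2.
Qed.
Canonical tensor_equiv :=
  EquivRel tensor_eq tensor_eq_refl tensor_eq_sym tensor_eq_trans.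

Definition tensor := {eq_quot tensor_equiv}.
HB.instance Definition _ := Choice.on tensor.
HB.instance Definition _ := EqQuotient.on tensor.

Definition tsum (s : tensor_sum) : tensor := \pi_tensor s.
Definition pure (a : A) (b : B) : tensor := tsum [:: (a, b)].
Local Notation "a ⊗ b" := (pure a b).

Lemma tsumP s t : tsum s = tsum t <-> tensor_cong s t.
Proof.
split=> [/eqP|h]; last by apply/eqP; rewrite eqmodE; apply/asboolP.
by rewrite eqmodE => /asboolP.
Qed.

Lemma tsum_repr x : tsum (repr x) = x.
Proof. exact: reprK. Qed.

Definition tadd (x y : tensor) : tensor := tsum (repr x ++ repr y).
Definition topp (x : tensor) : tensor :=
  tsum [seq (- p.1, p.2) | p <- repr x].

Lemma tsum_cat s t : tsum (s ++ t) = tadd (tsum s) (tsum t).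
Proof.
by apply/tsumP/TC_add; apply/tsumP; rewrite tsum_repr.
Qed.

Lemma taddA : associative tadd.
Proof.
move=> x y z; rewrite -(tsum_repr x) -(tsum_repr y) -(tsum_repr z).
by rewrite -!tsum_cat catA.
Qed.
Lemma taddC : commutative tadd.
Proof.
move=> x y; rewrite -(tsum_repr x) -(tsum_repr y) -!tsum_cat.
exact/tsumP/TC_addC.
Qed.
Lemma tadd0 : left_id (tsum [::]) tadd.
Proof. by move=> x; rewrite -(tsum_repr x) -tsum_cat. Qed.
Lemma taddN : left_inverse (tsum [::]) topp tadd.
Proof.
move=> x; rewrite -{2}(tsum_repr x) /topp.
elim: (repr x) => [|[a b] s IH]; first exact: tadd0.
rewrite -cat1s map_cat !tsum_cat -taddA [X in tadd _ X]taddC -taddA.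
rewrite [X in tadd _ (tadd _ X)]taddC IH [X in tadd _ X]taddC tadd0.
rewrite -tsum_cat /=; apply/tsumP; apply: TC_trans (TC_zero b).
by rewrite -(addNr a); exact/TC_sym/TC_addl.
Qed.

HB.instance Definition _ :=
  GRing.isZmodule.Build tensor taddA taddC tadd0 taddN.

Lemma pureDl a a' b : (a + a') ⊗ b = a ⊗ b + a' ⊗ b.
Proof. by rewrite /GRing.add /= -tsum_cat; exact/tsumP/TC_addl. Qed.
Lemma pureDr a b b' : a ⊗ (b + b') = a ⊗ b + a ⊗ b'.
Proof. by rewrite /GRing.add /= -tsum_cat; exact/tsumP/TC_addr. Qed.
Lemma pureZ (k : K) a b : (k%:S * a) ⊗ b = a ⊗ (k%:S * b).
Proof. exact/tsumP/TC_scale. Qed.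
Lemma pure0l b : 0 ⊗ b = 0.
Proof. exact/tsumP/TC_zero. Qed.
Lemma pure0r a : a ⊗ 0 = 0.
Proof. by rewrite -[0 in LHS](mul0r (0 : B)) -scal0 -pureZ scal0 mul0r pure0l. Qed.

Lemma tsumE s : tsum s = \sum_(p <- s) p.1 ⊗ p.2.
Proof.
elim: s => [|[a b] s IH]; first by rewrite big_nil.
by rewrite big_cons -IH -cat1s tsum_cat.
Qed.

Lemma tensor_ind (P : tensor -> Prop) :
  P 0 -> (forall x y, P x -> P y -> P (x + y)) -> (forall a b, P (a ⊗ b)) ->
  forall x, P x.
Proof.
move=> P0 PD Pp x; rewrite -(tsum_repr x) tsumE.
by elim/big_ind: _ => // p _; exact: Pp.
Qed.

(* Meaningful when f is bilinear: see [tlift_pure]. *)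
Definition tlift (V : zmodType) (f : A -> B -> V) (x : tensor) : V :=
  \sum_(p <- (repr x : tensor_sum)) f p.1 p.2.

Definition bilin (V : zmodType) (f : A -> B -> V) : Prop :=
  [/\ forall a a' b, f (a + a') b = f a b + f a' b,
      forall a b b', f a (b + b') = f a b + f a b' &
      forall (k : K) a b, f (k%:S * a) b = f a (k%:S * b)].

Section Lift.
Variables (V : zmodType) (f : A -> B -> V).
Hypothesis fP : bilin f.

Lemma tlift_sum s : tlift f (tsum s) = \sum_(p <- s) f p.1 p.2.
Proof.
have [fDl fDr fZ] := fP.
rewrite /tlift; have : tensor_cong (repr (tsum s)) s.
  by apply/tsumP; rewrite tsum_repr.
move: (repr (tsum s)) => s'; elim=> {s s'} //=.
- by move=> s t r _ -> _ ->.
- by move=> s s' t t' _ IH1 _ IH2; rewrite !big_cat /= IH1 IH2.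
- by move=> s t; rewrite !big_cat /= addrC.
- move=> b; rewrite big_seq1 big_nil /=.
  by apply: (addrI (f 0 b)); rewrite -fDl !addr0.
- by move=> a a' b; rewrite !big_cons big_nil /= fDl !addr0.
- by move=> a b b'; rewrite !big_cons big_nil /= fDr !addr0.
- by move=> k a b; rewrite !big_seq1 /= fZ.
Qed.

Lemma tlift_pure a b : tlift f (a ⊗ b) = f a b.
Proof. by rewrite tlift_sum big_seq1. Qed.

Lemma tliftD : {morph tlift f : x y / x + y}.
Proof.
move=> x y; rewrite -(tsum_repr x) -(tsum_repr y) /GRing.add /= -tsum_cat.
by rewrite !tlift_sum big_cat.
Qed.
End Lift.

Definition tscal (k : K) : tensor := k%:S ⊗ 1.

(* (a ⊗ b)(a' ⊗ b') = (-1)^{|b||a'|} aa' ⊗ bb', expanded over the homogeneous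
   components of b and a'; see [tmul_homog] below. *)
Definition tmul_pure (a : A) (b : B) (a' : A) (b' : B) : tensor :=
  \sum_(d : bool) \sum_(e : bool)
    (((-1) ^+ (d && e))%:S * (a * hpart e a')) ⊗ (hpart d b * b').

Definition tmul (x y : tensor) : tensor :=
  tlift (fun a b => tlift (tmul_pure a b) y) x.

Definition thpart (d : bool) : tensor -> tensor :=
  tlift (fun a b => \sum_(e : bool) hpart e a ⊗ hpart (d (+) e) b).

Lemma scalMC (C : superalgType K) (k : K) (a b : C) :
  a * (k%:S * b) = k%:S * (a * b).
Proof. by rewrite mulrA -scalC mulrA. Qed.

Lemma tmul_pure_bilin a b : bilin (tmul_pure a b).
Proof.
split=> [a1 a2 b'|a' b1 b2|k a' b']; rewrite /tmul_pure -?big_split /=;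
  apply: eq_bigr => d _; rewrite -?big_split /=; apply: eq_bigr => e _.
- by rewrite hpartD !mulrDr pureDl.
- by rewrite mulrDr pureDr.
- by rewrite hpartZ (scalMC k a) (scalMC k (_%:S)) pureZ (scalMC k (hpart d b)).
Qed.

Lemma tmul_pureDl a1 a2 b a' b' :
  tmul_pure (a1 + a2) b a' b' = tmul_pure a1 b a' b' + tmul_pure a2 b a' b'.
Proof.
rewrite /tmul_pure -big_split; apply: eq_bigr => d _ /=.
rewrite -big_split; apply: eq_bigr => e _ /=.
by rewrite mulrDl mulrDr pureDl.
Qed.

Lemma tmul_pureDr a b1 b2 a' b' :
  tmul_pure a (b1 + b2) a' b' = tmul_pure a b1 a' b' + tmul_pure a b2 a' b'.
Proof.
rewrite /tmul_pure -big_split; apply: eq_bigr => d _ /=.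
rewrite -big_split; apply: eq_bigr => e _ /=.
by rewrite hpartD mulrDl pureDr.
Qed.

Lemma tmul_pureZ (k : K) a b a' b' :
  tmul_pure (k%:S * a) b a' b' = tmul_pure a (k%:S * b) a' b'.
Proof.
apply: eq_bigr => d _; apply: eq_bigr => e _.
by rewrite hpartZ -(mulrA k%:S a) (scalMC k) pureZ -(mulrA k%:S (hpart d b)).
Qed.

Lemma tmul_bilin y : bilin (fun a b => tlift (tmul_pure a b) y).
Proof.
split=> [a1 a2 b|a b1 b2|k a b]; rewrite /tlift.
- by rewrite -big_split; apply: eq_bigr => p _; exact: tmul_pureDl.
- by rewrite -big_split; apply: eq_bigr => p _; exact: tmul_pureDr.
- by apply: eq_bigr => p _; exact: tmul_pureZ.
Qed.

Lemma tmul_pureE a b a' b' : tmul (a ⊗ b) (a' ⊗ b') = tmul_pure a b a' b'.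
Proof.
by rewrite /tmul (tlift_pure (tmul_bilin _)) (tlift_pure (tmul_pure_bilin _ _)).
Qed.

Lemma tmulDl : left_distributive tmul +%R.
Proof. by move=> x y z; rewrite /tmul (tliftD (tmul_bilin _)). Qed.

Lemma tmulDr : right_distributive tmul +%R.
Proof.
move=> x y z; rewrite /tmul /tlift -big_split /=; apply: eq_bigr => p _.
exact: (tliftD (tmul_pure_bilin _ _)).
Qed.

Lemma tmul0l y : tmul 0 y = 0.
Proof. by apply: (addrI (tmul 0 y)); rewrite -tmulDl !addr0. Qed.
Lemma tmul0r y : tmul y 0 = 0.
Proof. by apply: (addrI (tmul y 0)); rewrite -tmulDr !addr0. Qed.

Lemma tmul_homog d e a b a' b' : homogeneous d b -> homogeneous e a' ->
  tmul (a ⊗ b) (a' ⊗ b') = (((-1) ^+ (d && e))%:S * (a * a')) ⊗ (b * b').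
Proof.
move=> hb ha'; rewrite tmul_pureE /tmul_pure (bigD1 d) //= (bigD1 e) //=.
rewrite ha' hb big1 ?addr0; last first.
  by move=> f /negPf fe; rewrite (homogeneousE _ ha') fe !mulr0 pure0l.
rewrite big1 ?addr0 // => g /negPf gd; rewrite big1 // => f _.
by rewrite (homogeneousE _ hb) gd mul0r pure0r.
Qed.

Lemma tensor_hind (P : tensor -> Prop) :
  P 0 -> (forall x y, P x -> P y -> P (x + y)) ->
  (forall d e a b, homogeneous d a -> homogeneous e b -> P (a ⊗ b)) ->
  forall x, P x.
Proof.
move=> P0 PD Pp; apply: tensor_ind => // a b.
rewrite -(hpart_sum a) -(hpart_sum b) pureDl !pureDr.
by apply: (PD); apply: (PD); apply: (Pp); exact: hpart_homog.
Qed.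

Lemma sign_scal_homog (C : superalgType K) d (k : K) (a : C) :
  homogeneous d a -> homogeneous d (k%:S * a).
Proof. by move=> ha; rewrite /homogeneous hpartZ ha. Qed.

Lemma tmulA : associative tmul.
Proof.
move=> x y z; elim/tensor_hind: x => [|x x' IH IH'|d e a b ha hb].
- by rewrite !tmul0l.
- by rewrite !tmulDl IH IH'.
elim/tensor_hind: y => [|y y' IH IH'|d' e' a' b' ha' hb'].
- by rewrite tmul0l tmul0r tmul0l.
- by rewrite tmulDl !tmulDr tmulDl IH IH'.
elim/tensor_hind: z => [|z z' IH IH'|d2 e2 a2 b2 ha2 hb2].
- by rewrite !tmul0r.
- by rewrite !tmulDr IH IH'.
rewrite (tmul_homog _ _ hb' ha2) (tmul_homog _ _ hb ha').
rewrite (tmul_homog _ _ hb (sign_scal_homog _ (homogM ha' ha2))).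
rewrite (tmul_homog _ _ (homogM hb hb') ha2) !mulrA; congr (_ ⊗ _).
rewrite -!mulrA (scalMC _ a) !mulrA -!scalM; congr (_%:S * _ * _ * _).
by case: e {hb}; case: e' {hb'}; case: d' {ha'}; case: d2 {ha2};
  rewrite /= ?expr0 ?expr1 ?mulrNN ?mulr1 ?mul1r.
Qed.

Lemma homog1 (C : superalgType K) : homogeneous false (1 : C).
Proof. exact: hpart1. Qed.
Lemma homog_scal (C : superalgType K) (k : K) : homogeneous false (k%:S : C).
Proof. exact: hpart_scal. Qed.

Lemma tmul1 : left_id (1 ⊗ 1) tmul.
Proof.
elim/tensor_hind => [|x y IH IH'|d e a b ha hb]; first exact: tmul0r.
  by rewrite tmulDr IH IH'.
by rewrite (tmul_homog _ _ (homog1 _) ha) /= expr0 scal1 !mul1r.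
Qed.
Lemma tmulr1 : right_id (1 ⊗ 1) tmul.
Proof.
elim/tensor_hind => [|x y IH IH'|d e a b ha hb]; first exact: tmul0l.
  by rewrite tmulDl IH IH'.
by rewrite (tmul_homog _ _ hb (homog1 _)) andbF /= expr0 scal1 mul1r !mulr1.
Qed.

HB.instance Definition _ :=
  GRing.Zmodule_isPzRing.Build tensor tmulA tmul1 tmulr1 tmulDl tmulDr.

Lemma mul_pure d e a b a' b' : homogeneous d b -> homogeneous e a' ->
  (a ⊗ b) * (a' ⊗ b') = (((-1) ^+ (d && e))%:S * (a * a')) ⊗ (b * b').
Proof. exact: tmul_homog. Qed.

Lemma tscal1 : tscal 1 = 1. Proof. by rewrite /tscal scal1. Qed.
Lemma tscalD : {morph tscal : k l / k + l}.
Proof. by move=> k l; rewrite /tscal scalD pureDl. Qed.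
Lemma tscal_pure k a b : tscal k * (a ⊗ b) = (k%:S * a) ⊗ b.
Proof.
rewrite -(hpart_sum a) pureDl !mulrDr pureDl.
by congr (_ + _); rewrite (mul_pure _ _ (homog1 _) (hpart_homog _ _)) /= expr0
  scal1 !mul1r.
Qed.
Lemma tscalM : {morph tscal : k l / k * l}.
Proof. by move=> k l; rewrite [tscal l]/tscal tscal_pure /tscal scalM. Qed.
Lemma tscalC k x : tscal k * x = x * tscal k.
Proof.
elim/tensor_hind: x => [|x y IH IH'|d e a b ha hb].
- by rewrite mulr0 mul0r.
- by rewrite mulrDr mulrDl IH IH'.
rewrite tscal_pure (mul_pure _ _ hb (homog_scal _ _)) andbF expr0 scal1 mul1r.
by rewrite mulr1 scalC.
Qed.

Lemma thpart_bilin d :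
  bilin (fun a b => \sum_(e : bool) hpart e a ⊗ hpart (d (+) e) b).
Proof.
split=> [a1 a2 b'|a' b1 b2|k a' b']; rewrite -?big_split /=;
  apply: eq_bigr => e _.
- by rewrite hpartD pureDl.
- by rewrite hpartD pureDr.
- by rewrite !hpartZ pureZ.
Qed.
Lemma thpartD d : {morph thpart d : x y / x + y}.
Proof. exact/tliftD/thpart_bilin. Qed.
Lemma thpart0 d : thpart d 0 = 0.
Proof. by apply: (addrI (thpart d 0)); rewrite -thpartD !addr0. Qed.
Lemma thpart_pure d e f a b : homogeneous e a -> homogeneous f b ->
  thpart d (a ⊗ b) = if d == e (+) f then a ⊗ b else 0.
Proof.
move=> ha hb; rewrite /thpart (tlift_pure (thpart_bilin _)) (bigD1 e) //=.
rewrite big1 ?addr0 => [|g /negPf ge]; last first.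
  by rewrite (homogeneousE _ ha) ge pure0l.
rewrite ha (homogeneousE _ hb) (_ : (d (+) e == f) = (d == e (+) f)).
  by case: ifP; rewrite ?pure0r.
by case: d; case: e {ha}; case: f {hb}.
Qed.
Lemma thpartZ d k x : thpart d (tscal k * x) = tscal k * thpart d x.
Proof.
elim/tensor_hind: x => [|x y IH IH'|e f a b ha hb].
- by rewrite !mulr0 thpart0 mulr0.
- by rewrite !(mulrDr, thpartD) IH IH'.
rewrite tscal_pure (thpart_pure _ (sign_scal_homog _ ha) hb).
by rewrite (thpart_pure _ ha hb); case: ifP; rewrite ?mulr0 ?tscal_pure.
Qed.
Lemma thpart_sum x : thpart false x + thpart true x = x.
Proof.
elim/tensor_hind: x => [|x y IH IH'|e f a b ha hb].
- by rewrite !thpart0 addr0.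
- by rewrite !thpartD addrACA IH IH'.
by rewrite !(thpart_pure _ ha hb); case: (e (+) f); rewrite ?addr0 ?add0r.
Qed.
Lemma thpart_thpart d e x :
  thpart d (thpart e x) = if d == e then thpart e x else 0.
Proof.
elim/tensor_hind: x => [|x y IH IH'|f g a b ha hb].
- by rewrite !thpart0 if_same.
- by rewrite !thpartD IH IH'; case: ifP; rewrite ?addr0.
rewrite (thpart_pure e ha hb); case: (eqVneq e) => [->|_].
  by rewrite (thpart_pure _ ha hb).
by rewrite thpart0 if_same.
Qed.
Lemma thpart_mul d e x y :
  thpart (d (+) e) (thpart d x * thpart e y) = thpart d x * thpart e y.
Proof.
elim/tensor_hind: x => [|x x' IH IH'|f g a b ha hb].
- by rewrite !(thpart0, mul0r).
- by rewrite !(thpartD, mulrDl) IH IH'.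
elim/tensor_hind: y => [|y y' IH IH'|f' g' a' b' ha' hb'].
- by rewrite !(thpart0, mulr0).
- by rewrite !(thpartD, mulrDr) IH IH'.
rewrite (thpart_pure d ha hb) (thpart_pure e ha' hb').
case: (eqVneq d) => [->|_]; last by rewrite mul0r thpart0.
case: (eqVneq e) => [->|_]; last by rewrite mulr0 thpart0.
rewrite (mul_pure _ _ hb ha').
rewrite (thpart_pure _ (sign_scal_homog _ (homogM ha ha')) (homogM hb hb')).
by rewrite addbACA eqxx.
Qed.

HB.instance Definition _ := isSuperalgebra.Build K tensor
  tscal1 tscalD tscalM tscalC thpartD thpartZ thpart_sum thpart_thpart
  thpart_mul.

End Tensor.

Notation "a ⊗ b" := (pure a b) : ring_scope.

Inductive term (K G : Type) : Type :=
| TGen of G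
| TConst of K
| TAdd of term K G & term K G
| TMul of term K G & term K G.
Arguments TGen {K G}.
Arguments TConst {K G}.

Declare Scope presentation_scope.
Delimit Scope presentation_scope with PT.
Bind Scope presentation_scope with term.
Notation "0" := (TConst 0%R) : presentation_scope.
Notation "1" := (TConst 1%R) : presentation_scope.
Notation "s + t" := (TAdd s%PT t%PT) : presentation_scope.
Notation "s * t" := (TMul s%PT t%PT) : presentation_scope.
Notation "k *: t" := (TMul (TConst k%R) t%PT) : presentation_scope.
Notation "- t" := (TMul (TConst (-1)%R) t%PT) : presentation_scope.
Notation "s - t" := (TAdd s%PT (TMul (TConst (-1)%R) t%PT)) : presentation_scope.
Definition tword (K : pzRingType) (G I : Type) (g : I -> term K G) (w : seq I) :
  term K G := foldr (fun i t => TMul (g i) t) 1%PT w.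
Definition texp (K : pzRingType) (G : Type) (t : term K G) (m : nat) :
  term K G := iter m (TMul t) 1%PT.
Notation "t ^+ m" := (texp t%PT m%N) : presentation_scope.

(* [homogT par d t]: t is syntactically homogeneous of parity d, when par is the
   parity of the generators. *)
Fixpoint homogT (K G : Type) (par : G -> bool) (d : bool) (t : term K G) : bool :=
  match t with
  | TGen g => par g == d
  | TConst _ => ~~ d
  | TAdd s t => homogT par d s && homogT par d t
  | TMul s t => (homogT par false s && homogT par d t)
             || (homogT par true s && homogT par (~~ d) t)
  end.

Record superpres (K : comNzRingType) := SuperPres {
  sp_gen : Type;
  sp_par : sp_gen -> bool;
  sp_rel : term K sp_gen -> term K sp_gen -> Prop;
  sp_homog : forall l r, sp_rel l r ->
    exists d, homogT sp_par d l && homogT sp_par d r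
}.

Section Presented.
Context {K : comNzRingType} (P : superpres K).
Local Notation G := (sp_gen P).
Local Notation par := (@sp_par K P).
Local Notation T := (term K G).

(* The smallest congruence that contains the relations of P and makes the
   quotient a unital associative K-algebra. *)
Inductive pcong : T -> T -> Prop :=
| PC_rel l r : sp_rel l r -> pcong l r
| PC_refl s : pcong s s
| PC_sym s t : pcong s t -> pcong t s
| PC_trans s t r : pcong s t -> pcong t r -> pcong s r
| PC_add s s' t t' : pcong s s' -> pcong t t' -> pcong (s + t) (s' + t')
| PC_mul s s' t t' : pcong s s' -> pcong t t' -> pcong (s * t) (s' * t')
| PC_addA s t r : pcong (s + (t + r)) (s + t + r)
| PC_addC s t : pcong (s + t) (t + s)
| PC_add0 t : pcong (0 + t) t
| PC_mulA s t r : pcong (s * (t * r)) (s * t * r)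
| PC_mul1 t : pcong (1 * t) t
| PC_mul0 t : pcong (0 * t) 0
| PC_mulDl s t r : pcong ((s + t) * r) (s * r + t * r)
| PC_mulDr s t r : pcong (s * (t + r)) (s * t + s * r)
| PC_constD k l : pcong (TConst (k + l)) (TConst k + TConst l)
| PC_constM k l : pcong (TConst (k * l)) (TConst k * TConst l)
| PC_constC k t : pcong (TConst k * t) (t * TConst k).

HB.instance Definition _ := gen_eqMixin T.
HB.instance Definition _ := gen_choiceMixin T.

Definition pequiv (s t : T) : bool := `[< pcong s t >].

Lemma pequiv_refl : reflexive pequiv.
Proof. by move=> s; apply/asboolP; exact: PC_refl. Qed.
Lemma pequiv_sym : symmetric pequiv.
Proof. by move=> s t; apply/asboolP/asboolP; exact: PC_sym. Qed.
Lemma pequiv_trans : transitive pequiv.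
Proof.
by move=> s t r /asboolP h1 /asboolP h2; apply/asboolP; exact: PC_trans h1 h2.
Qed.
Canonical pequiv_rel := EquivRel pequiv pequiv_refl pequiv_sym pequiv_trans.

Definition presented := {eq_quot pequiv_rel}.
HB.instance Definition _ := Choice.on presented.
HB.instance Definition _ := EqQuotient.on presented.

Definition pcl (t : T) : presented := \pi_presented t.
Definition pgen (g : G) : presented := pcl (TGen g).

Lemma pclP s t : pcl s = pcl t <-> pcong s t.
Proof.
split=> [/eqP|h]; last by apply/eqP; rewrite eqmodE; apply/asboolP.
by rewrite eqmodE => /asboolP.
Qed.
Lemma pcl_repr x : pcl (repr x) = x.
Proof. exact: reprK. Qed.
Lemma repr_pcl t : pcong (repr (pcl t)) t.
Proof. by apply/pclP; rewrite pcl_repr. Qed.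

Definition padd (x y : presented) : presented := pcl (repr x + repr y).
Definition pmul (x y : presented) : presented := pcl (repr x * repr y).
Definition popp (x : presented) : presented := pcl (- repr x).
Definition pscal (k : K) : presented := pcl (TConst k).

Lemma pcl_add s t : pcl (s + t) = padd (pcl s) (pcl t).
Proof. by apply/pclP/PC_add; exact/PC_sym/repr_pcl. Qed.
Lemma pcl_mul s t : pcl (s * t) = pmul (pcl s) (pcl t).
Proof. by apply/pclP/PC_mul; exact/PC_sym/repr_pcl. Qed.

Lemma pind (Q : presented -> Prop) : (forall t, Q (pcl t)) -> forall x, Q x.
Proof. by move=> h x; rewrite -(pcl_repr x). Qed.

Lemma paddA : associative padd.
Proof.
elim/pind=> s; elim/pind=> t; elim/pind=> r; rewrite -!pcl_add.
exact/pclP/PC_addA.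
Qed.
Lemma paddC : commutative padd.
Proof. by elim/pind=> s; elim/pind=> t; rewrite -!pcl_add; exact/pclP/PC_addC. Qed.
Lemma padd0 : left_id (pscal 0) padd.
Proof. by elim/pind=> s; rewrite -pcl_add; exact/pclP/PC_add0. Qed.
Lemma paddN : left_inverse (pscal 0) popp padd.
Proof.
move=> x; rewrite -{2}(pcl_repr x) /popp -pcl_add; apply/pclP.
set t := repr x; apply: (PC_trans (t := (-1 + 1) *: t)); last first.
  by rewrite addNr; exact: PC_mul0.
apply: PC_sym; apply: PC_trans (PC_mul (PC_constD _ _) (PC_refl _)) _.
apply: PC_trans (PC_mulDl _ _ _) _.
by apply: PC_add; [exact: PC_refl | exact: PC_mul1].
Qed.
HB.instance Definition _ :=
  GRing.isZmodule.Build presented paddA paddC padd0 paddN.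

Lemma pmulA : associative pmul.
Proof.
elim/pind=> s; elim/pind=> t; elim/pind=> r; rewrite -!pcl_mul.
exact/pclP/PC_mulA.
Qed.
Lemma pmul1 : left_id (pscal 1) pmul.
Proof. by elim/pind=> s; rewrite -pcl_mul; exact/pclP/PC_mul1. Qed.
Lemma pscalC' k x : pmul (pscal k) x = pmul x (pscal k).
Proof. by elim/pind: x => s; rewrite -!pcl_mul; exact/pclP/PC_constC. Qed.
Lemma pmulr1 : right_id (pscal 1) pmul.
Proof. by move=> x; rewrite -pscalC' pmul1. Qed.
Lemma pmulDl : left_distributive pmul padd.
Proof.
elim/pind=> s; elim/pind=> t; elim/pind=> r; rewrite -!(pcl_mul, pcl_add).
exact/pclP/PC_mulDl.
Qed.
Lemma pmulDr : right_distributive pmul padd.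
Proof.
elim/pind=> s; elim/pind=> t; elim/pind=> r; rewrite -!(pcl_mul, pcl_add).
exact/pclP/PC_mulDr.
Qed.
HB.instance Definition _ :=
  GRing.Zmodule_isPzRing.Build presented pmulA pmul1 pmulr1 pmulDl pmulDr.

Lemma pclD s t : pcl (s + t) = pcl s + pcl t. Proof. exact: pcl_add. Qed.
Lemma pclM s t : pcl (s * t) = pcl s * pcl t. Proof. exact: pcl_mul. Qed.

Fixpoint term_hpart (d : bool) (t : T) : T :=
  match t with
  | TGen g => if par g == d then TGen g else 0
  | TConst k => if d then 0 else TConst k
  | TAdd s t => term_hpart d s + term_hpart d t
  | TMul s t => term_hpart false s * term_hpart d t + term_hpart true s * term_hpart (~~ d) t
  end%PT.
Definition phpart (d : bool) (x : presented) : presented := pcl (term_hpart d (repr x)).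

Lemma term_hpart_mulE d s t : pcl (term_hpart d (s * t)) =
  pcl (term_hpart false s) * pcl (term_hpart d t) + pcl (term_hpart true s) * pcl (term_hpart (~~ d) t).
Proof. by rewrite /= pclD !pclM. Qed.
Lemma term_hpart_addE d s t : pcl (term_hpart d (s + t)) = pcl (term_hpart d s) + pcl (term_hpart d t).
Proof. by rewrite /= pclD. Qed.
Lemma term_hpart_constE d k : pcl (term_hpart d (TConst k)) = if d then 0 else pscal k.
Proof. by case: d. Qed.

Lemma term_hpart_homog d e t : homogT par e t ->
  pcl (term_hpart d t) = if d == e then pcl t else 0.
Proof.
elim: t d e => [g|k|s IHs t IHt|s IHs t IHt] d e.
- by rewrite /= => /eqP ->; rewrite eq_sym; case: ifP.
- by case: e d => [] // [].
- rewrite term_hpart_addE pclD /= => /andP[/IHs-> /IHt->].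
  by case: ifP; rewrite ?addr0.
rewrite term_hpart_mulE pclM /= => /orP[]/andP[/[dup]/IHs hs _ /IHt ht].
  rewrite !hs !ht /= mul0r addr0.
  by case: ifP; rewrite ?mulr0.
by rewrite !hs !ht /= mul0r add0r (inj_eq negb_inj); case: ifP; rewrite ?mulr0.
Qed.

Lemma term_hpart_cong d s t : pcong s t -> pcl (term_hpart d s) = pcl (term_hpart d t).
Proof.
move=> h; elim: h d => {s t}.
- move=> l r lr d; have [e /andP[hl hr]] := sp_homog lr.
  rewrite (term_hpart_homog _ hl) (term_hpart_homog _ hr); case: ifP => // _.
  exact/pclP/PC_rel.
- by [].
- by move=> s t _ IH d; rewrite IH.
- by move=> s t r _ IH _ IH' d; rewrite IH.
- by move=> s s' t t' _ IH _ IH' d; rewrite !term_hpart_addE IH IH'.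
- by move=> s s' t t' _ IH _ IH' d; rewrite !term_hpart_mulE !IH !IH'.
- by move=> s t r d; rewrite !term_hpart_addE addrA.
- by move=> s t d; rewrite !term_hpart_addE addrC.
- by move=> t d; rewrite term_hpart_addE term_hpart_constE if_same add0r.
- move=> s t r d; rewrite !term_hpart_mulE !mulrDr !mulrDl !mulrA negbK.
  by rewrite [LHS](AC (2*2) ((1*4)*(2*3))).
- move=> t d; rewrite term_hpart_mulE !term_hpart_constE mul0r addr0.
  exact: mul1r.
- by move=> t d; rewrite term_hpart_mulE !term_hpart_constE if_same !mul0r addr0.
- by move=> s t r d; rewrite !(term_hpart_mulE, term_hpart_addE) !mulrDl addrACA.
- by move=> s t r d; rewrite !(term_hpart_mulE, term_hpart_addE) !mulrDr addrACA.
- move=> k l d; rewrite term_hpart_addE !term_hpart_constE; case: d; rewrite ?addr0 //.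
  by rewrite /pscal -pclD; exact/pclP/PC_constD.
- move=> k l d; rewrite term_hpart_mulE !term_hpart_constE; case: d => /=.
    by rewrite mulr0 mul0r addr0.
  by rewrite mul0r addr0 /pscal -pclM; exact/pclP/PC_constM.
- move=> k t d; rewrite !term_hpart_mulE !term_hpart_constE mul0r addr0.
  case: d => /=; rewrite mulr0 ?add0r ?addr0; exact: pscalC'.
Qed.

Lemma phpart_cl d t : phpart d (pcl t) = pcl (term_hpart d t).
Proof. exact/term_hpart_cong/repr_pcl. Qed.
Lemma phpartD d : {morph phpart d : x y / x + y}.
Proof.
by elim/pind=> s; elim/pind=> t; rewrite -pclD !phpart_cl term_hpart_addE.
Qed.
Lemma phpart_scal d k : phpart d (pscal k) = if d then 0 else pscal k.
Proof. by rewrite phpart_cl term_hpart_constE. Qed.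
Lemma phpartM d x y : phpart d (x * y) =
  phpart false x * phpart d y + phpart true x * phpart (~~ d) y.
Proof.
by elim/pind: x => s; elim/pind: y => t; rewrite -pclM !phpart_cl term_hpart_mulE.
Qed.
Lemma phpartZ d k x : phpart d (pscal k * x) = pscal k * phpart d x.
Proof. by rewrite phpartM !phpart_scal mul0r addr0. Qed.
Lemma phpart_sum x : phpart false x + phpart true x = x.
Proof.
elim/pind: x => t; rewrite !phpart_cl; elim: t => [g|k|s IHs t IHt|s IHs t IHt].
- by rewrite /=; case: (par g); rewrite /= ?add0r ?addr0.
- by rewrite !term_hpart_constE addr0.
- by rewrite !term_hpart_addE addrACA IHs IHt pclD.
rewrite !term_hpart_mulE pclM -[in RHS]IHs -[in RHS]IHt mulrDl !mulrDr.
by rewrite addrACA [X in _ + X]addrC.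
Qed.
Lemma phpart_phpart d e x :
  phpart d (phpart e x) = if d == e then phpart e x else 0.
Proof.
elim/pind: x => t; elim: t d e => [g|k|s IHs t IHt|s IHs t IHt] d e.
- rewrite phpart_cl /=; case: (eqVneq (par g) e) => [<-|_].
    by rewrite phpart_cl /= eq_sym; case: ifP.
  by rewrite (phpart_scal d 0) !if_same.
- by rewrite !phpart_scal; case: e d => [] [] /=; rewrite phpart_scal ?if_same.
- by rewrite pclD !phpartD IHs IHt; case: ifP; rewrite ?addr0.
rewrite pclM (phpartM e) phpartD !phpartM !IHs !IHt /=.
rewrite !mul0r addr0 add0r (inj_eq negb_inj).
by case: ifP; rewrite ?mulr0 ?addr0.
Qed.
Lemma phpart_mul d e x y :
  phpart (d (+) e) (phpart d x * phpart e y) = phpart d x * phpart e y.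
Proof.
rewrite phpartM !phpart_phpart.
by case: d; case: e; rewrite /= ?(mul0r, mulr0, addr0, add0r).
Qed.
Lemma pscalD : {morph pscal : k l / k + l}.
Proof. by move=> k l; rewrite /pscal -pclD; apply/pclP/PC_constD. Qed.
Lemma pscalM : {morph pscal : k l / k * l}.
Proof. by move=> k l; rewrite /pscal -pclM; apply/pclP/PC_constM. Qed.

HB.instance Definition _ := isSuperalgebra.Build K presented
  (erefl : pscal 1 = 1) pscalD pscalM pscalC' phpartD phpartZ phpart_sum
  phpart_phpart phpart_mul.

Lemma hpart_pgen d g : hpart d (pgen g) = if par g == d then pgen g else 0.
Proof. by rewrite /hpart /= phpart_cl /=; case: ifP. Qed.

Fixpoint teval (A : superalgType K) (g : G -> A) (t : T) : A :=
  match t with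
  | TGen i => g i
  | TConst k => k%:S
  | TAdd s t => teval g s + teval g t
  | TMul s t => teval g s * teval g t
  end.

Definition plift (A : superalgType K) (g : G -> A) (x : presented) : A :=
  teval g (repr x).

Lemma teval_pgen t : teval pgen t = pcl t.
Proof. by elim: t => //= s -> t ->; rewrite ?pclD ?pclM. Qed.

Lemma pgen_rel l r : sp_rel l r -> teval pgen l = teval pgen r.
Proof. by move=> h; rewrite !teval_pgen; apply/pclP/PC_rel. Qed.

Section Lift.
Variables (A : superalgType K) (g : G -> A).
Hypothesis g_par : forall i, homogeneous (par i) (g i).
Hypothesis g_rel : forall l r, sp_rel l r -> teval g l = teval g r.

Lemma teval_cong s t : pcong s t -> teval g s = teval g t.
Proof.
elim=> {s t} //=.
- by move=> s t r _ -> _ ->.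
- by move=> s s' t t' _ -> _ ->.
- by move=> s s' t t' _ -> _ ->.
- by move=> *; rewrite addrA.
- by move=> *; rewrite addrC.
- by move=> *; rewrite scal0 add0r.
- by move=> *; rewrite mulrA.
- by move=> *; rewrite scal1 mul1r.
- by move=> *; rewrite scal0 mul0r.
- by move=> *; rewrite mulrDl.
- by move=> *; rewrite mulrDr.
- exact: scalD.
- exact: scalM.
- by move=> *; rewrite scalC.
Qed.

Lemma plift_cl t : plift g (pcl t) = teval g t.
Proof. exact/teval_cong/repr_pcl. Qed.

Lemma plift_gen i : plift g (pgen i) = g i.
Proof. exact: plift_cl. Qed.

Lemma teval_hpart d t : teval g (term_hpart d t) = hpart d (teval g t).
Proof.
elim: t d => [i|k|s IHs t IHt|s IHs t IHt] d /=.
- by rewrite (homogeneousE _ (g_par i)) eq_sym; case: ifP; rewrite //= scal0.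
- by rewrite hpart_scal; case: d; rewrite //= scal0.
- by rewrite IHs IHt hpartD.
rewrite !IHs !IHt -[in RHS](hpart_sum (teval g s)).
rewrite -[in RHS](hpart_sum (teval g t)) mulrDl !mulrDr !hpartD.
have hm e f : hpart d (hpart e (teval g s) * hpart f (teval g t)) =
    if d == e (+) f then hpart e (teval g s) * hpart f (teval g t) else 0.
  exact/homogeneousE/homogM/hpart_homog/hpart_homog.
by rewrite !hm; case: d {hm}; rewrite /= ?(addr0, add0r).
Qed.

Lemma plift_morphism : superalg_morphism (plift g).
Proof.
split=> [x y|x y|k|d x].
- by elim/pind: x => s; elim/pind: y => t; rewrite -pclD !plift_cl.
- by elim/pind: x => s; elim/pind: y => t; rewrite -pclM !plift_cl.
- exact: plift_cl.
- move=> hx; rewrite /homogeneous -[in RHS]hx; elim/pind: x {hx} => t.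
  by rewrite {2}/hpart /= phpart_cl !plift_cl teval_hpart.
Qed.
End Lift.

Lemma presented_morph_uniq (A : superalgType K) (f h : presented -> A) :
  superalg_morphism f -> superalg_morphism h ->
  (forall i, f (pgen i) = h (pgen i)) -> f =1 h.
Proof.
move=> [fD fM fS _] [hD hM hS _] fh; elim/pind.
elim=> [i|k|s IHs t IHt|s IHs t IHt]; first exact: fh.
- by rewrite (fS k) (hS k).
- by rewrite pclD fD hD IHs IHt.
- by rewrite pclM fM hM IHs IHt.
Qed.

End Presented.

Inductive weyl_type := TypeB | TypeD.

(* Indices are 0-based: the mathematical index i in 1..n is the element of 'I_n
   of value i - 1.  Thus [i.+1 < n] says that node i is a node of S_n,
   [l.+1 = n] that l is the index n, [m.+2 = n] that m is n-1 and [k.+3 = n]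
   that k is n-2. *)
Section Relations.
Context {C : numClosedFieldType} (W : weyl_type) (n : nat) (u v : C).

Section OverGenerators.
Context {G : Type}.
Implicit Types c s : 'I_n -> term C G.

Inductive cliff_rel c : term C G -> term C G -> Prop :=
| cliff_sq (i : 'I_n) : cliff_rel c (c i * c i) 1
| cliff_anti (i j : 'I_n) : i != j -> cliff_rel c (c i * c j) (- (c j * c i)).

Inductive weyl_rel s : term C G -> term C G -> Prop :=
| weyl_sq (i : 'I_n) : weyl_rel s (s i * s i) 1
| weyl_braid (i j : 'I_n) : j = i.+1 :> nat -> (j.+1 < n)%N ->
    weyl_rel s (s i * s j * s i) (s j * s i * s j)
| weyl_far (i j : 'I_n) : (i.+1 < n)%N -> (j.+1 < n)%N -> (i.+1 < j)%N || (j.+1 < i)%N ->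
    weyl_rel s (s i * s j) (s j * s i)
| weyl_D_comm (i l : 'I_n) : W = TypeD -> l.+1 = n -> i.+3 != n ->
    weyl_rel s (s i * s l) (s l * s i)
| weyl_D_braid (k l : 'I_n) : W = TypeD -> k.+3 = n -> l.+1 = n ->
    weyl_rel s (s k * s l * s k) (s l * s k * s l)
| weyl_B_comm (i l : 'I_n) : W = TypeB -> l.+1 = n -> (i.+2 < n)%N ->
    weyl_rel s (s i * s l) (s l * s i)
| weyl_B_braid (m l : 'I_n) : W = TypeB -> m.+2 = n -> l.+1 = n ->
    weyl_rel s ((s m * s l) ^+ 4) 1.
End OverGenerators.

(* The image of i under the permutation s_{k_1} ... s_{k_r}, where
   w = [:: k_1; ..; k_r]. *)
Definition word_act (w : seq 'I_n) (i : 'I_n) : 'I_n :=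
  foldr (fun k j => tperm k (ordS k) j) i w.

Inductive hc_gen := HcX of 'I_n | HcC of 'I_n | HcS of 'I_n.
Definition hc_par (g : hc_gen) : bool := if g is HcC _ then true else false.

Section HeckeClifford.
Local Notation x i := (TGen (HcX i)).
Local Notation c i := (TGen (HcC i)).
Local Notation s i := (TGen (HcS i)).

Inductive hc_rel : term C hc_gen -> term C hc_gen -> Prop :=
| hc_weyl l r : weyl_rel (fun i => s i) l r -> hc_rel l r
| hc_cliff l r : cliff_rel (fun i => c i) l r -> hc_rel l r
| hc_xx (i j : 'I_n) : hc_rel (x i * x j) (x j * x i)
| hc_xc_same (i : 'I_n) : hc_rel (x i * c i) (- (c i * x i))
| hc_xc (i j : 'I_n) : i != j -> hc_rel (x i * c j) (c j * x i)
| hc_perm (w : seq 'I_n) (i : 'I_n) : all (fun k : 'I_n => (k.+1 < n)%N) w ->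
    hc_rel (tword (fun k => s k) w * c i)
           (c (word_act w i) * tword (fun k => s k) w)
| hc_xs (i j : 'I_n) : j = i.+1 :> nat ->
    hc_rel (x j * s i - s i * x i) (u *: (1 - c j * c i))
| hc_xs_far (i j : 'I_n) : (i.+1 < n)%N -> j != i -> j != i.+1 :> nat ->
    hc_rel (x j * s i) (s i * x j)
| hc_D_sc (m l : 'I_n) : W = TypeD -> m.+2 = n -> l.+1 = n ->
    hc_rel (s l * c l) (- (c m * s l))
| hc_D_sc_far (i l : 'I_n) : W = TypeD -> l.+1 = n -> i.+2 != n -> i != l ->
    hc_rel (s l * c i) (c i * s l)
| hc_D_sx (m l : 'I_n) : W = TypeD -> m.+2 = n -> l.+1 = n ->
    hc_rel (s l * x l + x m * s l) ((- u) *: (1 + c m * c l))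
| hc_D_sx_far (i l : 'I_n) : W = TypeD -> l.+1 = n -> i.+2 != n -> i != l ->
    hc_rel (s l * x i) (x i * s l)
| hc_B_sc (l : 'I_n) : W = TypeB -> l.+1 = n -> hc_rel (s l * c l) (- (c l * s l))
| hc_B_sc_far (i l : 'I_n) : W = TypeB -> l.+1 = n -> i != l ->
    hc_rel (s l * c i) (c i * s l)
| hc_B_sx (l : 'I_n) : W = TypeB -> l.+1 = n ->
    hc_rel (s l * x l + x l * s l) (TConst (- (sqrtC 2 * v))%R)
| hc_B_sx_far (i l : 'I_n) : W = TypeB -> l.+1 = n -> i != l ->
    hc_rel (s l * x i) (x i * s l).
End HeckeClifford.

Inductive hs_gen := HsB of 'I_n | HsT of 'I_n.

Section SpinHecke.
Local Notation b i := (TGen (HsB i)).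
Local Notation t i := (TGen (HsT i)).

Inductive hs_rel : term C hs_gen -> term C hs_gen -> Prop :=
| hs_sq (i : 'I_n) : hs_rel (t i * t i) 1
| hs_braid (i j : 'I_n) : j = i.+1 :> nat -> (j.+1 < n)%N ->
    hs_rel (t i * t j * t i) (t j * t i * t j)
| hs_far (i j : 'I_n) : (i.+1 < n)%N -> (j.+1 < n)%N -> (i.+1 < j)%N || (j.+1 < i)%N ->
    hs_rel (t i * t j) (- (t j * t i))
| hs_D_comm (i l : 'I_n) : W = TypeD -> l.+1 = n -> i.+3 != n -> i != l ->
    hs_rel (t i * t l) (- (t l * t i))
| hs_D_braid (k l : 'I_n) : W = TypeD -> k.+3 = n -> l.+1 = n ->
    hs_rel (t k * t l * t k) (t l * t k * t l)
| hs_B_comm (i l : 'I_n) : W = TypeB -> l.+1 = n -> (i.+2 < n)%N ->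
    hs_rel (t i * t l) (- (t l * t i))
| hs_B_braid (m l : 'I_n) : W = TypeB -> m.+2 = n -> l.+1 = n ->
    hs_rel ((t m * t l) ^+ 4) (TConst (-1)%R)
| hs_bb (i j : 'I_n) : i != j -> hs_rel (b i * b j) (- (b j * b i))
| hs_tb (i j : 'I_n) : j = i.+1 :> nat -> hs_rel (t i * b i + b j * t i) (TConst u)
| hs_tb_far (i j : 'I_n) : (i.+1 < n)%N -> j != i -> j != i.+1 :> nat ->
    hs_rel (t i * b j) (- (b j * t i))
| hs_D_tb (m l : 'I_n) : W = TypeD -> m.+2 = n -> l.+1 = n ->
    hs_rel (t l * b l + b m * t l) (TConst u)
| hs_D_tb_far (i l : 'I_n) : W = TypeD -> l.+1 = n -> i.+2 != n -> i != l ->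
    hs_rel (t l * b i) (- (b i * t l))
| hs_B_tb (l : 'I_n) : W = TypeB -> l.+1 = n ->
    hs_rel (t l * b l + b l * t l) (TConst v)
| hs_B_tb_far (i l : 'I_n) : W = TypeB -> l.+1 = n -> i != l ->
    hs_rel (t l * b i) (- (b i * t l)).
End SpinHecke.

Definition cliff_par (_ : 'I_n) : bool := true.

Lemma cliff_homog l r : cliff_rel (@TGen C 'I_n) l r ->
  exists d, homogT cliff_par d l && homogT cliff_par d r.
Proof. by case=> *; exists false. Qed.

Lemma tword_homog w :
  homogT hc_par false (tword (fun k => TGen (HcS k) : term C hc_gen) w).
Proof. by elim: w => //= k w ->. Qed.

Lemma hc_homog l r : hc_rel l r ->
  exists d, homogT hc_par d l && homogT hc_par d r.
Proof.
have even l' r' : homogT hc_par false l' && homogT hc_par false r' ->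
  exists d, homogT hc_par d l' && homogT hc_par d (r' : term C _).
  by exists false.
have odd l' r' : homogT hc_par true l' && homogT hc_par true r' ->
  exists d, homogT hc_par d l' && homogT hc_par d (r' : term C _).
  by exists true.
case; try (by move=> *; apply: even); try (by move=> *; apply: odd).
- by move=> l' r' [] *; apply: even.
- by move=> l' r' [] *; apply: even.
- by move=> w i _; apply: odd; rewrite /= tword_homog.
Qed.

Definition hs_par (_ : hs_gen) : bool := true.

Lemma hs_homog l r : hs_rel l r ->
  exists d, homogT hs_par d l && homogT hs_par d r.
Proof. by case=> *; first [by exists false | by exists true]. Qed.

End Relations.

Section Algebras.
Context {C : numClosedFieldType}.

Definition clifford_pres (n : nat) : superpres C := SuperPres (@cliff_homog C n).
(* The parameter v plays no role in type D. *)
Definition hecke_clifford_pres (W : weyl_type) (n : nat) (u v : C) :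
  superpres C := SuperPres (@hc_homog C W n u v).
Definition spin_hecke_pres (W : weyl_type) (n : nat) (u v : C) :
  superpres C := SuperPres (@hs_homog C W n u v).

End Algebras.

Arguments clifford_pres C n : clear implicits.

Notation clifford C n := (presented (clifford_pres C n)).
Notation hecke_clifford W n u v := (presented (hecke_clifford_pres W n u v)).
Notation spin_hecke W n u v := (presented (spin_hecke_pres W n u v)).

Section Generators.
Context {C : numClosedFieldType} {W : weyl_type} {n : nat} {u v : C}.
Implicit Type i : 'I_n.

Definition clc i : clifford C n := pgen (P := clifford_pres C n) i.

Definition hcx i : hecke_clifford W n u v :=
  pgen (P := hecke_clifford_pres W n u v) (HcX i).
Definition hcc i : hecke_clifford W n u v :=
  pgen (P := hecke_clifford_pres W n u v) (HcC i).
Definition hcs i : hecke_clifford W n u v :=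
  pgen (P := hecke_clifford_pres W n u v) (HcS i).

Definition hsb i : spin_hecke W n u v :=
  pgen (P := spin_hecke_pres W n u v) (HsB i).
Definition hst i : spin_hecke W n u v :=
  pgen (P := spin_hecke_pres W n u v) (HsT i).

(* The canonical map from the Clifford algebra, sending c_i to c_i. *)
Definition hc_clifford : clifford C n -> hecke_clifford W n u v :=
  plift (P := clifford_pres C n) hcc.

Lemma hcc_par i : homogeneous (cliff_par i) (hcc i).
Proof. by rewrite /homogeneous [LHS]hpart_pgen. Qed.

Lemma hcc_rel l r : sp_rel (s := clifford_pres C n) l r ->
  teval (P := clifford_pres C n) hcc l = teval (P := clifford_pres C n) hcc r.
Proof.
case=> [i|i j ij].
- exact: (pgen_rel (P := hecke_clifford_pres W n u v)
    (hc_cliff _ _ _ (cliff_sq _ i))).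
- exact: (pgen_rel (P := hecke_clifford_pres W n u v)
    (hc_cliff _ _ _ (cliff_anti _ ij))).
Qed.

Lemma hc_clifford_morphism : superalg_morphism hc_clifford.
Proof. exact: (plift_morphism (P := clifford_pres C n) hcc_par hcc_rel). Qed.

Lemma hc_clifford_gen i : hc_clifford (clc i) = hcc i.
Proof. exact: (plift_gen (P := clifford_pres C n) hcc_rel). Qed.
End Generators.

Definition beta {C : numClosedFieldType} (W : weyl_type) (n : nat) (i : 'I_n) : clifford C n :=
  if (i.+1 < n)%N then ((sqrtC 2)^-1)%:S * (clc i - clc (ordS i))
  else match W with
       | TypeD => ((sqrtC 2)^-1)%:S * (clc (ord_pred i) + clc i)
       | TypeB => clc i
       end.

(* Main.v *)
(** A Clifford root [beta_i] is an odd involution, and conjugation by it is,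
    up to sign, the reflection [s_i] acting on the Clifford generators.
    Inside any superalgebra containing Clifford generators [c_i], the
    substitution [s_i = - 'i beta_i t_i], [x_i = sqrt(-2) c_i b_i] is therefore
    invertible and turns "[s_i] and [x_i] act on the [c_j] as in the
    Hecke-Clifford algebra" into "[t_i] and [b_i] anticommute with the [c_j]";
    under it each remaining relation for [(s, x)] is a relation for [(t, b)]
    multiplied by an invertible element. This yields algebra maps in both
    directions. They are mutually inverse because the map out of the tensor
    product is linear over the Hecke-Clifford algebra, which is checked on
    generators. *)
Require Import Defs.
From mathcomp Require Import all_boot all_order all_algebra perm zify.
Set Implicit Arguments.
Unset Strict Implicit.
Unset Printing Implicit Defensive.
Import GRing.Theory Num.Theory.
Local Open Scope ring_scope.

(** * Sign rules for anticommuting elements *)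

Section Anticommutation.
Context {K : comNzRingType} {A : superalgType K}.
Implicit Types a b p q y z : A.

Definition anticomm a b : Prop := a * b = - (b * a).

Lemma anticomm_sym a b : anticomm a b -> anticomm b a.
Proof. by rewrite /anticomm => ->; rewrite opprK. Qed.

Lemma anticommDr a b b' : anticomm a b -> anticomm a b' -> anticomm a (b + b').
Proof. by rewrite /anticomm mulrDr mulrDl opprD => -> ->. Qed.

Lemma anticommNr a b : anticomm a b -> anticomm a (- b).
Proof. by rewrite /anticomm mulrN mulNr => ->. Qed.

Lemma involI p a b : p * p = 1 -> p * a = p * b -> a = b.
Proof.
move=> pp /(congr1 (fun z => p * z)).
by rewrite !mulrA pp !mul1r.
Qed.

Lemma mul_anticomm p q y z : anticomm q y ->
  (p * y) * (q * z) = - (p * q * (y * z)).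
Proof.
by move/anticomm_sym=> qy; rewrite !mulrA -(mulrA p) qy mulrN mulrA !mulNr.
Qed.

Lemma mul_comm4 p q y z : y * q = q * y ->
  (p * y) * (q * z) = p * q * (y * z).
Proof. by move=> qy; rewrite !mulrA -(mulrA p) qy mulrA. Qed.

Lemma anticomm_comm q y z : anticomm q y -> anticomm q z -> y * z * q = q * (y * z).
Proof.
move=> /anticomm_sym qy /anticomm_sym qz.
by rewrite -mulrA qz mulrN (mulrA y) qy mulNr opprK mulrA.
Qed.

Lemma involN a : a * a = 1 -> - a * - a = 1.
Proof. by rewrite mulrNN. Qed.

End Anticommutation.

(** * Normalised sums of two anticommuting involutions *)

Section Bisectors.
Context {C : numClosedFieldType} {A : superalgType C}.
Implicit Types (a b d y : A) (k : C).

Lemma anticommZr k a b : anticomm a b -> anticomm a (k%:S * b).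
Proof. by move=> h; rewrite /anticomm scalMC (h : a * b = _) mulrN mulrA. Qed.

Lemma scalI k a b : k != 0 -> k%:S * a = k%:S * b -> a = b.
Proof.
move=> k0 /(congr1 (fun z => (k^-1)%:S * z)).
by rewrite !mulrA -scalM mulVf // scal1 !mul1r.
Qed.

Lemma mul_scal k k' a b : (k%:S * a) * (k'%:S * b) = (k * k')%:S * (a * b).
Proof. by rewrite -mulrA scalMC mulrA -scalM. Qed.

(** A root [c_i - c_j] is the bisector of [c_i] and [- c_j], and a root [c_i + c_j] that of [c_i]
    and [c_j]. One computation thus serves both shapes. *)
Definition bisect a b : A := (sqrtC 2)^-1%:S * (a + b).

Lemma sqrt2V_sqr : (sqrtC 2)^-1 * (sqrtC 2)^-1 = 2^-1 :> C.
Proof. by rewrite -invfM -expr2 sqrtCK. Qed.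

Lemma scal2 a : 2%:S * a = a + a.
Proof. by rewrite (_ : 2 = 1 + 1 :> C) // scalD scal1 mulrDl mul1r. Qed.

Lemma half_scal2 : (2^-1 : C)%:S * (1 + 1) = 1 :> A.
Proof. by rewrite -[1 + 1]scal2 mulrA -scalM mulVf ?pnatr_eq0 // scal1 mul1r. Qed.

Lemma anticomm_bisect y a b : anticomm y a -> anticomm y b -> anticomm y (bisect a b).
Proof. by move=> ya yb; exact/anticommZr/anticommDr. Qed.

Section Bisect.
Context {a b : A} (aa : a * a = 1) (bb : b * b = 1) (ab : anticomm a b).

(** The cross terms cancel and half of [1 + 1] remains; this is what the factor [1 / sqrt 2] is
    for. *)
Lemma bisect_sqr : bisect a b * bisect a b = 1.
Proof.
rewrite mul_scal sqrt2V_sqr -half_scal2 mulrDl [a * _]mulrDr [b * _]mulrDr.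
by rewrite aa bb (ab : a * b = _) addrA addrNK.
Qed.

(** Both sides expand to [1 + b a] up to the scalar. Together with [bisect_mulr], conjugation by the
    bisector swaps [a] and [b]. *)
Lemma bisect_mull : bisect a b * a = b * bisect a b.
Proof.
by rewrite scalMC -mulrA; congr (_ * _); rewrite mulrDl mulrDr aa bb addrC.
Qed.

Lemma bisect_mulr : bisect a b * b = a * bisect a b.
Proof.
by rewrite scalMC -mulrA; congr (_ * _); rewrite mulrDl mulrDr aa bb addrC.
Qed.

(** Swapping [a] and [b] negates [a - b]. In type D these are the two orthogonal roots at the fork,
    which share both coordinates. *)
Lemma bisect_anticomm_bisectN : anticomm (bisect a b) (bisect a (- b)).
Proof.
rewrite /anticomm [bisect a (- b)]/bisect scalMC -mulrA -mulrN.
congr (_ * _); rewrite mulrDr mulrN bisect_mull bisect_mulr mulrDl mulNr.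
by rewrite opprD opprK addrC.
Qed.

End Bisect.

(** Two involutions with [p q + q p = - 1] satisfy the braid relation, since [p q p] and [q p q]
    both reduce to [- p - q]. *)
Lemma bisect_braid a b d :
  a * a = 1 -> b * b = 1 -> d * d = 1 ->
  anticomm a b -> anticomm a d -> anticomm b d ->
  bisect a (- b) * bisect b (- d) * bisect a (- b) =
  bisect b (- d) * bisect a (- b) * bisect b (- d).
Proof.
move=> aa bb dd ab ad bd; set p := bisect a (- b); set q := bisect b (- d).
have pp : p * p = 1 by apply: bisect_sqr => //; [exact: involN|exact: anticommNr].
have qq : q * q = 1 by apply: bisect_sqr => //; [exact: involN|exact: anticommNr].
(* The anticommutator of two unit vectors is twice their inner product, here [- 1 / 2]: only [b] is
   shared, with opposite signs. *)
have pq : p * q = - 1 - q * p.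
  apply/eqP; rewrite eq_sym subr_eq eq_sym -half_scal2 -mulrN.
  rewrite !mul_scal sqrt2V_sqr -mulrDr; apply/eqP; congr (_ * _).
  rewrite !(mulrBl, mulrBr) bb (ab : a * b = _) (ad : a * d = _) (bd : b * d = _).
  rewrite !(opprD, opprK) (AC ((2*2)*(2*2)) ((1*5)*(2*7)*(4*8)*(3*6))) /=.
  by rewrite !addNr subrr !add0r.
clearbody p q.
rewrite -[in RHS](mulrA q) pq mulrBl mulrBr mulrN1 mulN1r -mulrA pp mulrA qq.
by rewrite mulr1 mul1r addrC.
Qed.
End Bisectors.

(** * Clifford roots and their relations with each other and with the Clifford generators *)

Section Roots.
Context {C : numClosedFieldType} {A : superalgType C}.
Context (W : weyl_type) (n : nat) (c : 'I_n -> A).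
Hypothesis n_ge : match W with TypeD => (4 <= n)%N | TypeB => (2 <= n)%N end.
Hypothesis c_sqr : forall i, c i * c i = 1.
Hypothesis c_anti : forall i j, i != j -> anticomm (c i) (c j).

(** The formula of [beta], read for a Clifford family in an arbitrary superalgebra, so that it
    applies both in the tensor product and in the Hecke-Clifford algebra. *)
Definition croot (i : 'I_n) : A :=
  if (i.+1 < n)%N then bisect (c i) (- c (ordS i))
  else match W with
       | TypeD => bisect (c (ord_pred i)) (c i)
       | TypeB => c i
       end.

Lemma croot_S (i j : 'I_n) : j = i.+1 :> nat -> croot i = bisect (c i) (- c j).
Proof.
move=> ji; have lt_i : (i.+1 < n)%N by rewrite -ji.
rewrite /croot lt_i; congr (bisect _ (- c _)); apply: val_inj.
by rewrite /= modn_small // ji.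
Qed.

Lemma croot_D (m l : 'I_n) : W = TypeD -> m.+2 = n -> l.+1 = n ->
  croot l = bisect (c m) (c l).
Proof.
move=> WD mn ln; rewrite /croot ln ltnn WD; congr (bisect (c _) _).
(* [ord_pred] is computed modulo [n], as the remainder of [(l + n).-1]. *)
apply: val_inj; rewrite /= (_ : (l + n).-1 = m + n)%N; last by lia.
by rewrite modnDr modn_small.
Qed.

Lemma croot_B (l : 'I_n) : W = TypeB -> l.+1 = n -> croot l = c l.
Proof. by move=> WB ln; rewrite /croot ln ltnn WB. Qed.

(** The kinds of nodes of the Dynkin diagram, each with the index of the second Clifford generator
    occurring in its root, if there is one. *)
Variant node_spec (i : 'I_n) : Prop :=
| NodeS (j : 'I_n) of j = i.+1 :> nat & (i.+1 < n)%N
| NodeD (m : 'I_n) of W = TypeD & m.+2 = n & i.+1 = n & m != i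
| NodeB of W = TypeB & i.+1 = n.

Lemma nodeP i : node_spec i.
Proof.
have [lt_i|ge_i] := ltnP i.+1 n; first exact: (@NodeS i (Ordinal lt_i)).
have i_n : i.+1 = n by apply/eqP; rewrite eqn_leq ge_i ltn_ord.
case EW: W n_ge => hn; first exact: NodeB.
have lt_m : (n.-2 < n)%N by lia.
by apply: (@NodeD i (Ordinal lt_m)) => //; rewrite -?val_eqE /=; lia.
Qed.

Lemma ord_neq (i j : 'I_n) : (i != j :> nat) -> i != j.
Proof. by rewrite val_eqE. Qed.

Lemma croot_anticomm i y : (forall j, anticomm y (c j)) -> anticomm y (croot i).
Proof.
move=> yc; rewrite /croot; case: ifP => _.
  exact/anticomm_bisect/anticommNr.
by case: W; [exact: yc|exact: anticomm_bisect].
Qed.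

Lemma c_antiN i j : i != j -> anticomm (c i) (- c j).
Proof. by move=> ij; exact/anticommNr/c_anti. Qed.

Lemma croot_sqr i : croot i * croot i = 1.
Proof.
case: (nodeP i) => [j ji _|m WD mn i_n mi|WB i_n].
- rewrite (croot_S ji); apply: bisect_sqr => //; first exact: involN.
  by apply/c_antiN/ord_neq; rewrite ji; lia.
- by rewrite (croot_D WD mn) //; apply: bisect_sqr => //; exact: c_anti.
- by rewrite croot_B.
Qed.

(** The bisector of [c_i] and [- c_j] exchanges these two, so conjugation by the root is minus the
    transposition of [c_i] and [c_j]. *)
Lemma croot_c_l (i j : 'I_n) : j = i.+1 :> nat -> croot i * c i = - (c j * croot i).
Proof.
by move=> ji; rewrite (croot_S ji) (bisect_mull (c_sqr _) (involN (c_sqr _))) mulNr.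
Qed.

Lemma croot_c_r (i j : 'I_n) : j = i.+1 :> nat -> croot i * c j = - (c i * croot i).
Proof.
move=> ji; apply: oppr_inj; rewrite -mulrN opprK (croot_S ji).
by rewrite (bisect_mulr (c_sqr _) (involN (c_sqr _))).
Qed.

Lemma croot_c_far (i j : 'I_n) : (i.+1 < n)%N -> j != i -> j != i.+1 :> nat ->
  anticomm (croot i) (c j).
Proof.
move=> lt_i ji jSi; have [k ki _|m _ _ i_n|_ i_n] := nodeP i; try by lia.
rewrite (croot_S ki); apply/anticomm_sym/anticomm_bisect; first exact: c_anti.
by apply/c_antiN/ord_neq; rewrite ki.
Qed.

(** The last root of type D bisects [c_m] and [c_l], which are therefore exchanged with no sign,
    whereas the reflection [s_l] exchanges them with a sign. *)
Lemma croot_D_c (m l : 'I_n) : W = TypeD -> m.+2 = n -> l.+1 = n ->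
  croot l * c l = c m * croot l /\ croot l * c m = c l * croot l.
Proof.
by move=> WD mn ln; rewrite (croot_D WD mn ln) bisect_mull // bisect_mulr.
Qed.

Lemma croot_D_c_far (i l : 'I_n) : W = TypeD -> l.+1 = n -> i.+2 != n -> i != l ->
  anticomm (croot l) (c i).
Proof.
move=> WD ln i_n il; have [j jl lt_l|m _ mn _ ml|WB _] := nodeP l; first by lia.
  rewrite (croot_D WD mn ln); apply/anticomm_sym/anticomm_bisect/c_anti => //.
  by apply/c_anti/ord_neq; lia.
by rewrite WD in WB.
Qed.

Lemma croot_B_c_far (i l : 'I_n) : W = TypeB -> l.+1 = n -> i != l ->
  anticomm (croot l) (c i).
Proof. by move=> WB ln il; rewrite croot_B //; apply/anticomm_sym/c_anti. Qed.

Lemma croot_braid (i j : 'I_n) : j = i.+1 :> nat -> (j.+1 < n)%N ->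
  croot i * croot j * croot i = croot j * croot i * croot j.
Proof.
move=> ji lt_j; have [k kj _|m _ _ i_n|_ i_n] := nodeP j; try by lia.
rewrite (croot_S ji) (croot_S kj).
by apply: bisect_braid => //; apply/c_anti/ord_neq; lia.
Qed.

Lemma croot_D_braid (k l : 'I_n) : W = TypeD -> k.+3 = n -> l.+1 = n ->
  croot k * croot l * croot k = croot l * croot k * croot l.
Proof.
move=> WD kn ln; have [j jl lt_l|m _ mn _ ml|WB _] := nodeP l; first by lia.
  have mk : m = k.+1 :> nat by lia.
  (* With [- c l] as the third involution, the sum [c m + c l] takes the difference form required by
     [bisect_braid]. *)
  rewrite (croot_S mk) (croot_D WD mn ln) -[c l]opprK.
  apply: bisect_braid => //; do ?exact: involN; do ?apply: c_antiN;
    do ?apply: c_anti; apply: ord_neq; lia.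
by rewrite WD in WB.
Qed.

Lemma croot_far (i j : 'I_n) : (i.+1 < n)%N -> (j.+1 < n)%N ->
  (i.+1 < j)%N || (j.+1 < i)%N -> anticomm (croot i) (croot j).
Proof.
move=> lt_i lt_j ij; have [k kj _|m _ _ i_n|_ i_n] := nodeP j; try by lia.
rewrite (croot_S kj); apply: anticomm_bisect; last apply: anticommNr.
all: by apply: croot_c_far; rewrite -?val_eqE /=; lia.
Qed.

Lemma croot_D_comm (i l : 'I_n) : W = TypeD -> l.+1 = n -> i.+3 != n -> i != l ->
  anticomm (croot i) (croot l).
Proof.
move=> WD ln i_n il; have [j jl lt_l|m _ mn _ ml|WB _] := nodeP l; first by lia.
  (* Either [i] is the other end of the fork, with the same two coordinates as [l], or the root of
     [i] involves neither [c m] nor [c l]; [i.+3 != n] rules out the remaining overlap. *)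
  have [im|im] := eqVneq i m.
    have li : l = i.+1 :> nat by rewrite im; lia.
    rewrite (croot_S li) (croot_D WD mn ln) -im.
    by apply/anticomm_sym/bisect_anticomm_bisectN => //; exact: c_anti.
  have lt_i := ltn_ord i; have il' : i != l :> nat by rewrite val_eqE.
  have im' : m != i :> nat by rewrite val_eqE eq_sym.
  rewrite (croot_D WD mn ln).
    apply: anticomm_bisect; apply: croot_c_far; rewrite 1?eq_sym //; lia.
by rewrite WD in WB.
Qed.

Lemma croot_B_comm (i l : 'I_n) : W = TypeB -> l.+1 = n -> (i.+2 < n)%N ->
  anticomm (croot i) (croot l).
Proof.
move=> WB ln i_n; rewrite (croot_B WB ln).
by apply: croot_c_far; rewrite -?val_eqE /=; lia.
Qed.

(** The square of [p] is [c_l c_m], a product of two anticommuting involutions, whose square is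
    [- 1]. This is the source of the sign in the braid relation of the spin algebra of type B. *)
Lemma croot_B_braid (m l : 'I_n) : W = TypeB -> m.+2 = n -> l.+1 = n ->
  let p := croot m * croot l in p * (p * (p * p)) = - 1.
Proof.
move=> WB mn ln p.
have lm : l = m.+1 :> nat by lia.
have pE : p = - (c m * croot m) by rewrite /p (croot_B WB ln) (croot_c_r lm).
have pp : p * p = c l * c m.
  rewrite pE mulrNN mulrA -(mulrA (c m)) (croot_c_l lm) mulrN mulNr mulrA.
  rewrite -mulrA croot_sqr mulr1 (c_anti _ : c m * c l = _) ?opprK //.
  by apply: ord_neq; lia.
rewrite mulrA pp mulrA -(mulrA (c l)) (c_anti _ : c m * c l = _); last first.
  by apply: ord_neq; lia.
by rewrite mulrN mulrA c_sqr mul1r mulNr c_sqr.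
Qed.
End Roots.

(** * The substitution between [(s, x)] and [(t, b)] over a fixed Clifford family, relation by
    relation *)

Section Twist.
Context {C : numClosedFieldType} {A : superalgType C}.
Context (W : weyl_type) (n : nat) (u v : C) (c t b s x : 'I_n -> A).
Hypothesis n_ge : match W with TypeD => (4 <= n)%N | TypeB => (2 <= n)%N end.
Hypothesis c_sqr : forall i, c i * c i = 1.
Hypothesis c_anti : forall i j, i != j -> anticomm (c i) (c j).
Hypothesis ct_anti : forall i j, anticomm (c i) (t j).
Hypothesis cb_anti : forall i j, anticomm (c i) (b j).
Local Notation r := (croot W c).
Hypothesis sE : forall i, s i = (- 'i)%:S * (r i * t i).
Hypothesis xE : forall i, x i = (sqrtC 2 * 'i)%:S * (c i * b i).

Lemma croot_mulI i (y z : A) : r i * y = r i * z -> y = z.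
Proof. exact/involI/croot_sqr. Qed.

Lemma c_mulI i (y z : A) : c i * y = c i * z -> y = z.
Proof. exact: involI. Qed.

Lemma croot_t_anti i j : anticomm (r i) (t j).
Proof. by apply/anticomm_sym/croot_anticomm => k; exact/anticomm_sym/ct_anti. Qed.

Lemma croot_b_anti i j : anticomm (r i) (b j).
Proof. by apply/anticomm_sym/croot_anticomm => k; exact/anticomm_sym/cb_anti. Qed.

(** The scalar [(- 'i) ^+ 2 = - 1] cancels the sign from moving [t i] past [r j]. *)
Lemma twist_ss i j : s i * s j = r i * r j * (t i * t j).
Proof.
rewrite !sE mul_scal mulrNN -expr2 sqrCi (mul_anticomm _ _ (croot_t_anti _ _)).
by rewrite scalN scal1 mulN1r opprK.
Qed.

(** The third root passes the product of two [t] without a sign. *)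
Lemma twist_sss i j k :
  s i * s j * s k = (- 'i)%:S * (r i * r j * r k * (t i * t j * t k)).
Proof.
rewrite twist_ss sE scalMC (mul_comm4 _ _ (anticomm_comm _ _)) //;
  exact: croot_t_anti.
Qed.

Lemma twist_xx i j : x i * x j = 2%:S * (c i * c j * (b i * b j)).
Proof.
rewrite !xE mul_scal mulrACA -!expr2 sqrCi sqrtCK (mul_anticomm _ _ (cb_anti _ _)).
by rewrite mulrN1 scalN mulrNN.
Qed.

Lemma twist_scalar : - 'i * (sqrtC 2 * 'i) = sqrtC 2 :> C.
Proof. by rewrite mulrCA mulNr -expr2 sqrCi opprK mulr1. Qed.

Lemma twist_xs i j : x i * s j = - ((sqrtC 2)%:S * (c i * r j * (b i * t j))).
Proof.
rewrite xE sE mul_scal mulrC twist_scalar (mul_anticomm _ _ (croot_b_anti _ _)).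
by rewrite mulrN.
Qed.

Lemma twist_sx i j : s i * x j = - ((sqrtC 2)%:S * (r i * c j * (t i * b j))).
Proof.
rewrite xE sE mul_scal twist_scalar (mul_anticomm _ _ (ct_anti _ _)).
by rewrite mulrN.
Qed.

Lemma sqrtC2_neq0 : sqrtC 2 != 0 :> C.
Proof. by rewrite sqrtC_eq0 pnatr_eq0. Qed.

Lemma twist_sqr i : s i * s i = t i * t i.
Proof. by rewrite twist_ss croot_sqr // mul1r. Qed.

(** The sign from exchanging the roots turns commutation into anticommutation; the root factors then
    cancel, being involutions. *)
Lemma twist_comm i j : anticomm (r i) (r j) ->
  (s i * s j = s j * s i <-> anticomm (t i) (t j)).
Proof.
move=> rij; rewrite /anticomm !twist_ss (rij : r i * r j = _) mulNr -mulrN.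
rewrite -!mulrA; split=> [/croot_mulI|->].
  by move/croot_mulI => <-; rewrite opprK.
by rewrite opprK.
Qed.

Lemma twist_braid i j : r i * r j * r i = r j * r i * r j ->
  (s i * s j * s i = s j * s i * s j <-> t i * t j * t i = t j * t i * t j).
Proof.
move=> rij; rewrite !twist_sss rij; split=> [/scalI|-> //].
rewrite oppr_eq0 neq0Ci => /(_ isT).
by rewrite -!(mulrA (r _)) => /croot_mulI/croot_mulI/croot_mulI.
Qed.

(** The products [p] and [q'] commute, so the fourth power of [p q'] splits and [p] contributes
    [- 1]. The nesting to the right matches the unfolding of [texp]. *)
Lemma twist_pow4 i j :
  let p := r i * r j in p * (p * (p * p)) = - 1 ->
  let q := s i * s j in let q' := t i * t j in
  q * (q * (q * q)) = - (q' * (q' * (q' * q'))).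
Proof.
move=> p pp q q'.
have pq' : q' * p = p * q'.
  rewrite mulrA (anticomm_comm (croot_t_anti i i) (croot_t_anti i j)) -mulrA.
  by rewrite (anticomm_comm (croot_t_anti j i) (croot_t_anti j j)) mulrA.
have pw w : q' * w = w * q' -> q' * (p * w) = p * w * q'.
  by move=> qw; rewrite mulrA pq' -mulrA qw mulrA.
have p2 := pw _ pq'; have p3 := pw _ p2.
rewrite /q twist_ss -/p -/q' (mul_comm4 _ _ pq') (mul_comm4 _ _ p2).
by rewrite (mul_comm4 _ _ p3) pp mulN1r.
Qed.

Lemma twist_xx_anti i j : i != j ->
  (x i * x j = x j * x i <-> anticomm (b i) (b j)).
Proof.
move=> ij; rewrite /anticomm !twist_xx (c_anti ij : c i * c j = _) mulNr -mulrN.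
split=> [/scalI-/(_ _)|->]; last by rewrite opprK.
rewrite pnatr_eq0 => /(_ isT).
by rewrite -!mulrA => /c_mulI/c_mulI <-; rewrite opprK.
Qed.

Lemma twist_xs_comm i j : anticomm (r i) (c j) ->
  (x j * s i = s i * x j <-> anticomm (t i) (b j)).
Proof.
move=> rc; rewrite /anticomm twist_xs twist_sx (rc : r i * c j = _).
split=> [/oppr_inj/scalI|->]; last by rewrite mulrNN.
move=> /(_ sqrtC2_neq0); rewrite mulNr -mulrN -!mulrA => /c_mulI.
by move/croot_mulI ->; rewrite opprK.
Qed.

(** Cancels the invertible prefix that the mixed relations between [x] and [s] acquire in the next
    two lemmas. *)
Lemma twist_scalI i k (y z : A) :
  (sqrtC 2)%:S * (c k * r i * y) = (sqrtC 2)%:S * (c k * r i * z) -> y = z.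
Proof.
move/(scalI sqrtC2_neq0); rewrite -!mulrA => /c_mulI.
exact: croot_mulI.
Qed.

(** Moving the root past [c j] gives both products the same prefix. The sign in the hypothesis turns
    the difference into a sum; this is the case of the nodes of [S_n], the next lemma that of the
    last node. *)
Lemma twist_xs_minus i j k : r i * c j = - (c k * r i) ->
  x k * s i - s i * x j = - ((sqrtC 2)%:S * (c k * r i * (t i * b j + b k * t i))).
Proof.
move=> rc; rewrite twist_xs twist_sx rc opprK mulNr mulrN -opprD -mulrDr -mulrDr.
by rewrite addrC.
Qed.

Lemma twist_xs_plus i j k : r i * c j = c k * r i ->
  s i * x j + x k * s i = - ((sqrtC 2)%:S * (c k * r i * (t i * b j + b k * t i))).
Proof. by move=> rc; rewrite twist_xs twist_sx rc -opprD -!mulrDr. Qed.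

(** The sign from moving [c j] past [t i] absorbs the one in the root relation. Leaving [e] free
    allows a signed generator. *)
Lemma twist_sc i j e : r i * c j = - (e * r i) -> s i * c j = e * s i.
Proof.
move=> rc; rewrite sE -mulrA scalMC; congr (_ * _).
rewrite -mulrA -[t i * c j]opprK -(ct_anti j i) mulrN (mulrA (r i)) rc.
by rewrite mulNr opprK mulrA.
Qed.

Lemma twist_sc_perm (i j : 'I_n) : (i.+1 < n)%N ->
  s i * c j = c (tperm i (ordS i) j) * s i.
Proof.
move=> lt_i; have Si : ordS i = i.+1 :> nat by rewrite /= modn_small.
apply: twist_sc; case: tpermP => [->|->|/eqP ji /eqP jSi].
- exact: croot_c_l.
- exact: croot_c_r.
- by apply: croot_c_far => //; rewrite -Si val_eqE.
Qed.

Definition hc_gens (g : hc_gen n) : A :=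
  match g with HcX i => x i | HcC i => c i | HcS i => s i end.

Definition hs_gens (g : hs_gen n) : A :=
  match g with HsB i => b i | HsT i => t i end.

Local Notation hc_eval := (teval (P := hecke_clifford_pres W n u v) hc_gens).
Local Notation hs_eval := (teval (P := spin_hecke_pres W n u v) hs_gens).

Lemma twist_word (w : seq 'I_n) i : all (fun k : 'I_n => (k.+1 < n)%N) w ->
  hc_eval (tword (fun k => TGen (HcS k)) w) * c i =
  c (word_act w i) * hc_eval (tword (fun k => TGen (HcS k)) w).
Proof.
elim: w => [|k w IH] /=; first by rewrite scal1 mulr1 mul1r.
by case/andP=> lt_k /IH {}IH; rewrite -mulrA IH mulrA twist_sc_perm // mulrA.
Qed.

(** Identifies the prefix of [twist_xs_minus] with the Clifford factor in the relation between [x]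
    and [s]; times [- u] it gives [u (1 - c_j c_i)]. *)
Lemma croot_c_same (i j : 'I_n) : j = i.+1 :> nat ->
  (sqrtC 2)%:S * (c j * r i) = c j * c i - 1.
Proof.
move=> ji; rewrite (croot_S _ _ ji) scalMC mulrA -scalM divff ?sqrtC2_neq0 //.
by rewrite scal1 mul1r mulrBr c_sqr.
Qed.

Lemma croot_c_D (m l : 'I_n) : W = TypeD -> m.+2 = n -> l.+1 = n ->
  (sqrtC 2)%:S * (c m * r l) = 1 + c m * c l.
Proof.
move=> WD mn ln; rewrite (croot_D c n_ge WD mn ln) scalMC mulrA -scalM.
by rewrite divff ?sqrtC2_neq0 // scal1 mul1r mulrDr c_sqr.
Qed.

(** Relations within [s], within [x], or between the two come from their spin counterparts; those
    involving [c] otherwise follow from the Clifford and anticommutation hypotheses and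
    [twist_sc]. *)
Lemma spin_to_clifford_rel :
  (forall l r, hs_rel W u v l r -> hs_eval l = hs_eval r) ->
  forall l r, hc_rel W u v l r -> hc_eval l = hc_eval r.
Proof.
move=> H l0 r0; case=> {l0 r0}.
- move=> l0 r0; case=> {l0 r0}.
  + move=> i; have := H _ _ (hs_sq W u v i); rewrite /= => tt.
    by rewrite twist_sqr.
  + move=> i j ji lt_j; have := H _ _ (hs_braid W u v ji lt_j).
    by move=> /= h; apply/twist_braid => //;
      exact: croot_braid.
  + move=> i j lt_i lt_j ij; have := H _ _ (hs_far W u v lt_i lt_j ij).
    by rewrite /= scalN scal1 mulN1r => h; apply/twist_comm => //;
      exact: croot_far.
  (* The Weyl relation includes the trivial case [i = l], which the spin relation excludes. *)
  + move=> i l WD ln i_n /=; have [->//|il] := eqVneq i l.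
    have := H _ _ (hs_D_comm u v WD ln i_n il).
    by rewrite /= scalN scal1 mulN1r => h; apply/twist_comm => //;
      exact: croot_D_comm.
  + move=> k l WD kn ln; have := H _ _ (hs_D_braid u v WD kn ln).
    by move=> /= h; apply/twist_braid => //;
      exact: croot_D_braid.
  + move=> i l WB ln i_n; have := H _ _ (hs_B_comm u v WB ln i_n).
    by rewrite /= scalN scal1 mulN1r => h; apply/twist_comm => //;
      exact: croot_B_comm.
  + move=> m l WB mn ln; have := H _ _ (hs_B_braid u v WB mn ln).
    rewrite /= !scalN !scal1 !mulr1.
    by rewrite (twist_pow4 (croot_B_braid n_ge c_sqr c_anti WB mn ln)) // => ->;
      rewrite opprK.
- move=> l0 r0 [i|i j ij] /=; first by rewrite scal1.
  by rewrite scalN scal1 mulN1r; exact: c_anti.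
- move=> i j /=; have [->//|ij] := eqVneq i j; apply/twist_xx_anti => //.
  by have := H _ _ (hs_bb W u v ij); rewrite /= scalN scal1 mulN1r.
- move=> i /=; rewrite scalN scal1 mulN1r xE -mulrA scalMC -mulrN; congr (_ * _).
  by rewrite -mulrA -[b i * c i]opprK -(cb_anti i i) mulrN.
- move=> i j ij /=; rewrite xE -mulrA scalMC; congr (_ * _).
  rewrite -mulrA -[b i * c j]opprK -(cb_anti j i) mulrN (mulrA (c i)).
  by rewrite (c_anti ij : c i * c j = _) mulNr opprK mulrA.
- by move=> w i; exact: twist_word.
- move=> i j ji; have := H _ _ (hs_tb W u v ji).
  rewrite /= !scalN !scal1 !mulN1r (twist_xs_minus (croot_c_l W c_sqr ji)) // => ->.
  by rewrite mulrA croot_c_same // -scalC -mulrN opprB.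
- move=> i j lt_i ji jSi; apply/twist_xs_comm; first exact: croot_c_far.
  have := H _ _ (hs_tb_far W u v lt_i ji jSi).
  by rewrite /= scalN scal1 mulN1r.
- move=> m l WD mn ln /=; rewrite scalN scal1 mulN1r -mulNr; apply: twist_sc.
  by rewrite mulNr opprK; case: (croot_D_c n_ge c_sqr WD mn ln).
- move=> i l WD ln i_n il /=; exact/twist_sc/croot_D_c_far.
- move=> m l WD mn ln; have := H _ _ (hs_D_tb u v WD mn ln).
  have [rc _] := croot_D_c n_ge c_sqr WD mn ln.
  rewrite /= scalN (twist_xs_plus rc) => ->.
  by rewrite mulrA croot_c_D // -scalC mulNr scal1.
- move=> i l WD ln i_n il; have := H _ _ (hs_D_tb_far u v WD ln i_n il).
  rewrite /= scalN scal1 mulN1r => tb; apply/esym/twist_xs_comm => //.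
  exact: croot_D_c_far.
- move=> l WB ln /=; rewrite scalN scal1 mulN1r -mulNr; apply: twist_sc.
  by rewrite mulNr opprK croot_B.
- move=> i l WB ln il /=; exact/twist_sc/croot_B_c_far.
- move=> l WB ln; have := H _ _ (hs_B_tb u v WB ln).
  have rc : r l * c l = c l * r l by rewrite croot_B.
  (* The root is [c l] itself, so the prefix is [c_l ^+ 2 = 1] and only [- sqrt 2 v] remains. *)
  rewrite /= (twist_xs_plus rc) => ->; rewrite croot_B // c_sqr.
  by rewrite mul1r scalN scalM.
- move=> i l WB ln il; have := H _ _ (hs_B_tb_far u v WB ln il).
  rewrite /= scalN scal1 mulN1r => tb; apply/esym/twist_xs_comm => //.
  exact: croot_B_c_far.
Qed.

(** The same equivalences read backwards; where the right-hand side carries a parameter, the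
    invertible prefix is cancelled on both sides. *)
Lemma clifford_to_spin_rel :
  (forall l r, hc_rel W u v l r -> hc_eval l = hc_eval r) ->
  forall l r, hs_rel W u v l r -> hs_eval l = hs_eval r.
Proof.
move=> H l0 r0; case=> {l0 r0}.
- move=> i; have := H _ _ (hc_weyl u v (weyl_sq _ _ i)).
  by rewrite /= twist_sqr.
- move=> i j ji lt_j; have := H _ _ (hc_weyl u v (weyl_braid _ _ ji lt_j)).
  by move=> /= h; apply/twist_braid => //;
    exact: croot_braid.
- move=> i j lt_i lt_j ij; have := H _ _ (hc_weyl u v (weyl_far _ _ lt_i lt_j ij)).
  by rewrite /= scalN scal1 mulN1r => h; apply/twist_comm => //;
    exact: croot_far.
- move=> i l WD ln i_n il; have := H _ _ (hc_weyl u v (weyl_D_comm _ WD ln i_n)).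
  by rewrite /= scalN scal1 mulN1r => h; apply/twist_comm => //;
    exact: croot_D_comm.
- move=> k l WD kn ln; have := H _ _ (hc_weyl u v (weyl_D_braid _ WD kn ln)).
  by move=> /= h; apply/twist_braid => //;
    exact: croot_D_braid.
- move=> i l WB ln i_n; have := H _ _ (hc_weyl u v (weyl_B_comm _ WB ln i_n)).
  by rewrite /= scalN scal1 mulN1r => h; apply/twist_comm => //;
    exact: croot_B_comm.
- move=> m l WB mn ln; have := H _ _ (hc_weyl u v (weyl_B_braid _ WB mn ln)).
  rewrite /= !scalN !scal1 !mulr1.
  by rewrite (twist_pow4 (croot_B_braid n_ge c_sqr c_anti WB mn ln)) // => <-;
    rewrite opprK.
- move=> i j ij; have := H _ _ (hc_xx W u v i j).
  by rewrite /= scalN scal1 mulN1r => /(twist_xx_anti ij).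
- move=> i j ji; have := H _ _ (hc_xs W u v ji).
  rewrite /= !scalN !scal1 !mulN1r (twist_xs_minus (croot_c_l W c_sqr ji)) // => e.
  apply: (@twist_scalI i j); apply: oppr_inj; rewrite e; symmetry.
  by rewrite mulrA croot_c_same // -scalC -mulrN opprB.
- move=> i j lt_i ji jSi; have := H _ _ (hc_xs_far W u v lt_i ji jSi).
  by rewrite /= scalN scal1 mulN1r => h; apply/twist_xs_comm => //;
    exact: croot_c_far.
- move=> m l WD mn ln; have := H _ _ (hc_D_sx u v WD mn ln).
  have [rc _] := croot_D_c n_ge c_sqr WD mn ln.
  rewrite /= scalN (twist_xs_plus rc) => e.
  apply: (@twist_scalI l m); apply: oppr_inj; rewrite e; symmetry.
  by rewrite mulrA croot_c_D // -scalC mulNr scal1.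
- move=> i l WD ln i_n il; have := H _ _ (hc_D_sx_far u v WD ln i_n il).
  rewrite /= scalN scal1 mulN1r => /esym.
  by move=> /= h; apply/twist_xs_comm => //;
    exact: croot_D_c_far.
- move=> l WB ln; have := H _ _ (hc_B_sx u v WB ln).
  have rc : r l * c l = c l * r l by rewrite croot_B.
  rewrite /= (twist_xs_plus rc) => e.
  apply: (@twist_scalI l l); apply: oppr_inj; rewrite e; symmetry.
  by rewrite croot_B // c_sqr mul1r scalN scalM.
- move=> i l WB ln il; have := H _ _ (hc_B_sx_far u v WB ln il).
  rewrite /= scalN scal1 mulN1r => /esym.
  by move=> /= h; apply/twist_xs_comm => //;
    exact: croot_B_c_far.
Qed.
End Twist.

(** * Superalgebra morphisms and the two embeddings into a tensor product *)

Section Morphisms.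
Context {K : comNzRingType}.
Implicit Types A B D : superalgType K.

Lemma superalg_morphism_comp A B D (f : A -> B) (g : B -> D) :
  superalg_morphism f -> superalg_morphism g -> superalg_morphism (g \o f).
Proof.
move=> [fD fM fS fH] [gD gM gS gH]; split=> [a b|a b|k|d a ha] /=.
- by rewrite fD gD.
- by rewrite fM gM.
- by rewrite fS gS.
- exact/gH/fH.
Qed.

Lemma superalg_morphismZ A B (f : A -> B) k a :
  superalg_morphism f -> f (k%:S * a) = k%:S * f a.
Proof. by case=> _ fM fS _; rewrite fM fS. Qed.

Lemma superalg_morphismN A B (f : A -> B) a :
  superalg_morphism f -> f (- a) = - f a.
Proof.
move=> fm; rewrite -mulN1r -scal1 -scalN superalg_morphismZ //.
by rewrite scalN scal1 mulN1r.
Qed.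

(** Transports relations along a morphism: images of generators satisfy whatever the generators
    satisfy. *)
Lemma teval_morph (P : superpres K) A B (f : A -> B) g h t :
  superalg_morphism f -> (forall i, h i = f (g i)) ->
  teval (P := P) h t = f (teval (P := P) g t).
Proof.
move=> [fD fM fS _] hf; elim: t => //= p -> q ->.
- by rewrite fD.
- by rewrite fM.
Qed.

Section Tensor.
Context {A B : superalgType K}.
Implicit Types (a : A) (b : B).

Lemma pure1_mul a b : (a ⊗ (1 : B)) * ((1 : A) ⊗ b) = a ⊗ b.
Proof.
by rewrite (mul_pure _ _ (homog1 _) (homog1 _)) expr0 scal1 mul1r mulr1 mul1r.
Qed.

Lemma scal_pure k a b : k%:S * (a ⊗ b) = (k%:S * a) ⊗ b.
Proof. exact: tscal_pure. Qed.

Lemma pureNl a b : (- a) ⊗ b = - (a ⊗ b).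
Proof. by apply: (addrI (a ⊗ b)); rewrite -pureDl !subrr pure0l. Qed.

Lemma pure_homog d e a b : homogeneous d a -> homogeneous e b ->
  homogeneous (d (+) e) (a ⊗ b).
Proof.
by move=> ha hb; rewrite /homogeneous [LHS](thpart_pure _ ha hb) eqxx.
Qed.

Lemma pure_anticomm a b : homogeneous true a -> homogeneous true b ->
  anticomm (a ⊗ (1 : B)) ((1 : A) ⊗ b).
Proof.
move=> ha hb; rewrite /anticomm pure1_mul (mul_pure _ _ hb ha).
by rewrite expr1 scalN scal1 mul1r mulr1 mulN1r pureNl opprK.
Qed.

Lemma pure_l_morphism : superalg_morphism (fun a => a ⊗ (1 : B)).
Proof.
split=> [a a'|a a'|k|d a ha].
- exact: pureDl.
- rewrite -(hpart_sum a') !(mulrDr, pureDl).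
  by congr (_ + _); rewrite (mul_pure _ _ (homog1 _) (hpart_homog _ _)) expr0
    scal1 !mul1r.
- by [].
- by rewrite -[d]addbF; apply: pure_homog => //; exact: homog1.
Qed.

Lemma pure_r_morphism : superalg_morphism (fun b => (1 : A) ⊗ b).
Proof.
split=> [b b'|b b'|k|d b hb].
- exact: pureDr.
- rewrite -(hpart_sum b) !(mulrDl, pureDr).
  by congr (_ + _); rewrite (mul_pure _ _ (hpart_homog _ _) (homog1 _)) andbF
    expr0 scal1 !mul1r.
- by rewrite -[k%:S]mulr1 -pureZ mulr1.
- by rewrite -[d]addFb; apply: pure_homog => //; exact: homog1.
Qed.
End Tensor.
End Morphisms.

(** * The maps between the Hecke-Clifford algebra and the tensor product *)

Section Isomorphism.
Context {C : numClosedFieldType} (W : weyl_type) (n : nat) (u v : C).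
Hypothesis n_ge : match W with TypeD => (4 <= n)%N | TypeB => (2 <= n)%N end.
Local Notation Cl := (clifford C n).
Local Notation HC := (hecke_clifford W n u v).
Local Notation HS := (spin_hecke W n u v).
Local Notation Ten := (tensor Cl HS).
Local Notation hcc := (@hcc C W n u v).
Local Notation hcs := (@hcs C W n u v).
Local Notation hcx := (@hcx C W n u v).
Local Notation hst := (@hst C W n u v).
Local Notation hsb := (@hsb C W n u v).

Lemma clc_sqr i : clc i * clc i = 1 :> Cl.
Proof. exact: (pgen_rel (P := clifford_pres C n) (cliff_sq _ i)). Qed.

Lemma clc_anti i j : i != j -> anticomm (clc i : Cl) (clc j).
Proof.
move=> ij; have := pgen_rel (P := clifford_pres C n) (cliff_anti _ ij).
by rewrite /= scalN scal1 mulN1r.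
Qed.

Lemma clc_odd i : homogeneous true (clc i : Cl).
Proof. by rewrite /homogeneous [LHS]hpart_pgen. Qed.

Lemma hst_odd i : homogeneous true (hst i).
Proof. by rewrite /homogeneous [LHS]hpart_pgen. Qed.

Lemma hsb_odd i : homogeneous true (hsb i).
Proof. by rewrite /homogeneous [LHS]hpart_pgen. Qed.

Lemma hc_gens_odd (g : hc_gen n) :
  homogeneous (hc_par g) (hc_gens hcc hcs hcx g).
Proof. by case: g => i; rewrite /homogeneous [LHS]hpart_pgen. Qed.

(** Brings the results on [croot] to bear on images of [beta]. *)
Lemma beta_morph (A : superalgType C) (f : Cl -> A) i :
  superalg_morphism f -> f (beta W i) = croot W (f \o clc) i.
Proof.
move=> fm; have [fD _ _ _] := fm; rewrite /beta /croot /bisect.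
case: ifP => _; last case: W => //.
  by rewrite superalg_morphismZ // fD (superalg_morphismN _ fm).
by rewrite superalg_morphismZ // fD.
Qed.

Lemma beta_odd i : homogeneous true (beta W i : Cl).
Proof.
have hN d (a : Cl) : homogeneous d a -> homogeneous d (- a).
  by move=> ha; rewrite -mulN1r -scal1 -scalN; exact: sign_scal_homog.
rewrite /beta; case: ifP => _; [|case: W]; try exact: clc_odd.
all: apply/sign_scal_homog/homogD; try apply: hN; exact: clc_odd.
Qed.

(** * The map into the tensor product *)

Section ToTensor.
Let c i : Ten := clc i ⊗ 1.
Let t i : Ten := 1 ⊗ hst i.
Let b i : Ten := 1 ⊗ hsb i.
Let s i : Ten := (- 'i)%:S * (croot W c i * t i).
Let x i : Ten := (sqrtC 2 * 'i)%:S * (c i * b i).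

Lemma croot_pure i : croot W c i = beta W i ⊗ 1.
Proof. by rewrite (beta_morph _ pure_l_morphism). Qed.

Definition hc_to_tensor : HC -> Ten :=
  plift (P := hecke_clifford_pres W n u v) (hc_gens c s x).

Lemma hc_to_tensor_par (g : hc_gen n) : homogeneous (hc_par g) (hc_gens c s x g).
Proof.
case: g => i /=.
- apply: sign_scal_homog; rewrite [c i * b i]pure1_mul.
  exact: (pure_homog (clc_odd i) (hsb_odd i)).
- exact: (pure_homog (clc_odd i) (homog1 _)).
- apply: sign_scal_homog; rewrite croot_pure [_ * t i]pure1_mul.
  exact: (pure_homog (beta_odd i) (hst_odd i)).
Qed.

Lemma hc_to_tensor_rel l r : hc_rel W u v l r ->
  teval (P := hecke_clifford_pres W n u v) (hc_gens c s x) l =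
  teval (P := hecke_clifford_pres W n u v) (hc_gens c s x) r.
Proof.
have [_ cM _ _] := pure_l_morphism (A := Cl) (B := HS).
apply: (spin_to_clifford_rel (t := t) (b := b)) => //.
- by move=> i; rewrite /c -cM clc_sqr.
- by move=> i j ij; rewrite /c /anticomm -!cM clc_anti // pureNl.
- by move=> i j; exact: (pure_anticomm (clc_odd i) (hst_odd j)).
- by move=> i j; exact: (pure_anticomm (clc_odd i) (hsb_odd j)).
move=> {}l {}r lr.
(* [t] and [b] are images of the spin generators under the right embedding, hence satisfy the spin
   relations. *)
have E q := teval_morph (P := spin_hecke_pres W n u v) q pure_r_morphism
  (g := pgen (P := spin_hecke_pres W n u v)) (h := hs_gens t b).
by rewrite !E ?(pgen_rel (P := spin_hecke_pres W n u v) lr) //; case.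
Qed.

Lemma hc_to_tensor_morphism : superalg_morphism hc_to_tensor.
Proof.
exact: (plift_morphism (P := hecke_clifford_pres W n u v) hc_to_tensor_par
  hc_to_tensor_rel).
Qed.

Lemma hc_to_tensor_gen g :
  hc_to_tensor (pgen (P := hecke_clifford_pres W n u v) g) = hc_gens c s x g.
Proof. exact: (plift_gen (P := hecke_clifford_pres W n u v) hc_to_tensor_rel). Qed.

Lemma hc_to_tensor_clifford (z : Cl) : hc_to_tensor (hc_clifford z) = z ⊗ 1.
Proof.
have m := superalg_morphism_comp (@hc_clifford_morphism C W n u v)
  hc_to_tensor_morphism.
apply: (presented_morph_uniq (P := clifford_pres C n) m pure_l_morphism) => i.
by rewrite /= [hc_clifford _]hc_clifford_gen hc_to_tensor_gen.
Qed.

Lemma hc_to_tensor_s i : hc_to_tensor (hcs i) = (- 'i)%:S * (beta W i ⊗ hst i).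
Proof. by rewrite hc_to_tensor_gen /= /s croot_pure [_ * t i]pure1_mul. Qed.

Lemma hc_to_tensor_x i :
  hc_to_tensor (hcx i) = (sqrtC 2 * 'i)%:S * (clc i ⊗ hsb i).
Proof. by rewrite hc_to_tensor_gen /= /x [c i * _]pure1_mul. Qed.
End ToTensor.

(** * The map out of the tensor product and the two cancellations *)

Section FromTensor.
(** [t] and [b] are obtained by solving the substitution, using that [beta_i] and [c_i] are
    involutions. *)
Let t i : HC := 'i%:S * (hc_clifford (beta W i) * hcs i).
Let b i : HC := ((sqrtC 2 * 'i)^-1)%:S * (hcc i * hcx i).

Lemma hcc_sqr i : hcc i * hcc i = 1.
Proof.
exact: (pgen_rel (P := hecke_clifford_pres W n u v)
  (hc_cliff _ _ _ (cliff_sq _ i))).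
Qed.

Lemma hcc_anti i j : i != j -> anticomm (hcc i) (hcc j).
Proof.
move=> ij; have := pgen_rel (P := hecke_clifford_pres W n u v)
  (hc_cliff _ _ _ (cliff_anti _ ij)).
by rewrite /= scalN scal1 mulN1r.
Qed.

Lemma hc_clifford_beta i : hc_clifford (beta W i) = croot W hcc i.
Proof.
rewrite (beta_morph _ (@hc_clifford_morphism C W n u v)).
by congr (croot W _ i); apply: funext => j; exact: hc_clifford_gen.
Qed.

(* The relations of the Hecke-Clifford algebra say that [s_i c_j s_i] is, up to
   sign, the reflection of [c_j] in the root [beta_i]. *)
Lemma hcs_c i j : exists2 e : HC,
  hcs i * hcc j = e * hcs i & croot W hcc i * hcc j = - (e * croot W hcc i).
Proof.
pose R := pgen_rel (P := hecke_clifford_pres W n u v).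
have far : hcs i * hcc j = hcc j * hcs i -> anticomm (croot W hcc i) (hcc j) ->
    exists2 e : HC, hcs i * hcc j = e * hcs i &
                    croot W hcc i * hcc j = - (e * croot W hcc i).
  by move=> h1 h2; exists (hcc j).
case: (nodeP n_ge i) => [k ki lt_i|m WD mn i_n mi|WB i_n].
- exists (hcc (tperm i (ordS i) j)).
    (* A single reflection is the one-letter word of the permutation relation. *)
    have := R _ _ (@hc_perm _ W n u v [:: i] j _); rewrite /= lt_i => /(_ isT).
    by rewrite scal1 !mulr1.
  have Si : ordS i = i.+1 :> nat by rewrite /= modn_small.
  case: tpermP => [->|->|/eqP ji /eqP jSi].
  + exact: (croot_c_l W hcc_sqr).
  + exact: (croot_c_r W hcc_sqr).
  + by apply: (croot_c_far n_ge hcc_anti) => //; rewrite -Si val_eqE.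
- have [e1 e2] := croot_D_c n_ge hcc_sqr WD mn i_n.
  have := R _ _ (hc_D_sc u v WD mn i_n); rewrite /= scalN scal1 mulN1r => sc.
  have [->|ji] := eqVneq j i.
    by exists (- hcc m); rewrite mulNr ?opprK.
  have [->|jm] := eqVneq j m.
    (* The presentation only gives the action of [s_i] on [c_i]; multiplying it by the involution
       [s_i] on both sides gives the action on [c_m]. *)
    exists (- hcc i); rewrite mulNr ?opprK //.
    have := R _ _ (hc_weyl u v (weyl_sq W _ i)); rewrite /= scal1 => ss.
    apply: (involI ss); rewrite mulrA ss mul1r mulrN mulrA.
    by rewrite [hcs i * hcc i]sc mulNr opprK -mulrA [X in _ * X]ss mulr1.
  have j_n : j.+2 != n.
    by apply: contraNneq jm => jn; rewrite -val_eqE /=; apply/eqP; lia.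
  apply: far; last exact: (croot_D_c_far n_ge hcc_anti).
  exact: (R _ _ (hc_D_sc_far u v WD i_n j_n ji)).
- have [->|ji] := eqVneq j i.
    exists (- hcc i); rewrite mulNr ?opprK ?croot_B //.
    have := R _ _ (hc_B_sc u v WB i_n).
    by rewrite /= scalN scal1 mulN1r.
  apply: far; last exact: (croot_B_c_far hcc_anti).
  exact: (R _ _ (hc_B_sc_far u v WB i_n ji)).
Qed.

(** By [hcs_c], the root and [s_j] carry [c_i] to the same element with opposite signs, so their
    product anticommutes with [c_i]. *)
Lemma hc_t_anti i j : anticomm (hcc i) (t j).
Proof.
apply: anticommZr; rewrite hc_clifford_beta; have [e sc rc] := hcs_c j i.
have rr := croot_sqr n_ge hcc_sqr hcc_anti j.
have re : hcc i * croot W hcc j = - (croot W hcc j * e).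
  apply: (involI rr); rewrite mulrA rc mulNr -mulrA rr mulr1 mulrN.
  by rewrite mulrA rr mul1r.
by rewrite /anticomm mulrA re mulNr -!mulrA sc.
Qed.

Lemma hc_b_anti i j : anticomm (hcc i) (b j).
Proof.
apply: anticommZr.
have [->|ij] := eqVneq i j.
  have := pgen_rel (P := hecke_clifford_pres W n u v) (hc_xc_same W u v j).
  rewrite /= scalN scal1 mulN1r => xc.
  by rewrite /anticomm -mulrA [hcx j * _]xc mulrN opprK.
have xc : hcx j * hcc i = hcc i * hcx j.
  apply: (pgen_rel (P := hecke_clifford_pres W n u v) (hc_xc W u v _)).
  by rewrite eq_sym.
rewrite /anticomm -mulrA xc.
by rewrite !mulrA (hcc_anti ij : hcc i * hcc j = _) mulNr.
Qed.

Lemma hcs_t i : hcs i = (- 'i)%:S * (croot W hcc i * t i).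
Proof.
rewrite /t hc_clifford_beta scalMC !mulrA -scalM mulNr -expr2 sqrCi opprK.
by rewrite scal1 mul1r (croot_sqr n_ge hcc_sqr hcc_anti) mul1r.
Qed.

Lemma hcx_b i : hcx i = (sqrtC 2 * 'i)%:S * (hcc i * b i).
Proof.
rewrite /b scalMC !mulrA -scalM divff ?scal1 ?mul1r ?hcc_sqr ?mul1r //.
by rewrite mulf_neq0 ?sqrtC2_neq0 ?neq0Ci.
Qed.

Definition hs_to_hc : HS -> HC :=
  plift (P := spin_hecke_pres W n u v) (hs_gens t b).

Lemma hcc_odd i : homogeneous true (hcc i).
Proof. exact: (hc_gens_odd (HcC i)). Qed.

Lemma hs_to_hc_par (g : hs_gen n) : homogeneous (hs_par g) (hs_gens t b g).
Proof.
case: g => i /=; apply: sign_scal_homog.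
  exact: (homogM (hcc_odd i) (hc_gens_odd (HcX i))).
have [_ _ _ cH] := @hc_clifford_morphism C W n u v.
exact: (homogM (cH _ _ (beta_odd i)) (hc_gens_odd (HcS i))).
Qed.

Lemma hs_to_hc_rel l r : hs_rel W u v l r ->
  teval (P := spin_hecke_pres W n u v) (hs_gens t b) l =
  teval (P := spin_hecke_pres W n u v) (hs_gens t b) r.
Proof.
apply: (clifford_to_spin_rel n_ge hcc_sqr hcc_anti hc_t_anti hc_b_anti hcs_t hcx_b).
move=> {}l {}r lr.
(* [hc_gens] agrees with [pgen] only after a case split on the generator; the identity morphism
   transfers evaluation between them. *)
have idm : superalg_morphism (@id HC) by split.
have E q := teval_morph (P := hecke_clifford_pres W n u v) q idm
  (g := pgen (P := hecke_clifford_pres W n u v)) (h := hc_gens hcc hcs hcx).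
by rewrite !E ?(pgen_rel (P := hecke_clifford_pres W n u v) lr) //; case.
Qed.

Lemma hs_to_hc_morphism : superalg_morphism hs_to_hc.
Proof.
exact: (plift_morphism (P := spin_hecke_pres W n u v) hs_to_hc_par hs_to_hc_rel).
Qed.

Lemma hs_to_hc_gen g :
  hs_to_hc (pgen (P := spin_hecke_pres W n u v) g) = hs_gens t b g.
Proof. exact: (plift_gen (P := spin_hecke_pres W n u v) hs_to_hc_rel). Qed.

Section OddElement.
Context (z : HC) (cz : forall i, anticomm (hcc i) z).

Let supercomm (d : bool) (y : HC) : Prop := z * y = ((-1) ^+ d)%:S * (y * z).

Lemma supercommD d y w : supercomm d y -> supercomm d w -> supercomm d (y + w).
Proof. by rewrite /supercomm !mulrDr mulrDl => -> ->; rewrite mulrDr. Qed.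

Lemma supercommM d e y w :
  supercomm d y -> supercomm e w -> supercomm (d (+) e) (y * w).
Proof.
rewrite /supercomm => hy hw.
by rewrite mulrA hy -!mulrA hw scalMC [LHS]mulrA -scalM signr_addb.
Qed.

(** Anticommuting with each generator propagates to the sign rule on the whole Clifford image, by
    induction on terms. *)
Lemma hc_clifford_supercomm (a : Cl) d :
  homogeneous d a -> supercomm d (hc_clifford a).
Proof.
have [cD cM cS _] := @hc_clifford_morphism C W n u v.
(* Writing [a] as a homogeneous component of a term, for every [d] at once, lets the product case
   use components of both parities. *)
move=> <-; rewrite -(pcl_repr (P := clifford_pres C n) a); move: (repr _) d => {a}.
have s0 d : supercomm d (hc_clifford 0).
  by rewrite -scal0 cS scal0 /supercomm mulr0 mul0r mulr0.
elim=> [i|k|p IHp q IHq|p IHp q IHq] d.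
- rewrite [hpart _ _](hpart_pgen (P := clifford_pres C n)).
  case: eqP => [<-|_]; last exact: s0.
  rewrite [hc_clifford _]hc_clifford_gen /supercomm expr1 scalN scal1 mulN1r.
  exact/anticomm_sym/cz.
- rewrite [hpart _ _]hpart_scal; case: d => /=; first exact: s0.
  by rewrite cS /supercomm expr0 scal1 mul1r scalC.
- by rewrite pclD hpartD cD; exact: supercommD.
- rewrite pclM [hpart _ _]phpartM cD !cM; apply: supercommD.
    by rewrite -[d]addFb; apply: supercommM; [exact: IHp|exact: IHq].
  have {1}-> : d = true (+) ~~ d by rewrite addTb negbK.
  by apply: supercommM; [exact: IHp|exact: IHq].
Qed.
End OddElement.

Let from_pure (a : Cl) (h : HS) : HC := hc_clifford a * hs_to_hc h.

Lemma from_pure_bilin : bilin from_pure.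
Proof.
have [cD cM cS _] := @hc_clifford_morphism C W n u v.
have [hD hM hS _] := hs_to_hc_morphism.
split=> [a a' h|a h h'|k a h]; rewrite /from_pure.
- by rewrite cD mulrDl.
- by rewrite hD mulrDr.
- by rewrite cM hM cS hS scalMC mulrA.
Qed.

Let ten_ind := @tensor_ind C Cl HS.
Let ten_hind := @tensor_hind C Cl HS.

Definition tensor_to_hc : Ten -> HC := tlift from_pure.

Lemma tensor_to_hc_pure a h : tensor_to_hc (a ⊗ h) = hc_clifford a * hs_to_hc h.
Proof. exact: (tlift_pure from_pure_bilin). Qed.

Lemma tensor_to_hcD : {morph tensor_to_hc : y w / y + w}.
Proof. exact: (tliftD from_pure_bilin). Qed.

Lemma tensor_to_hc0 : tensor_to_hc 0 = 0.
Proof. by apply: (addrI (tensor_to_hc 0)); rewrite -tensor_to_hcD !addr0. Qed.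

Lemma tensor_to_hcZ k y : tensor_to_hc (k%:S * y) = k%:S * tensor_to_hc y.
Proof.
have [_ cM cS _] := @hc_clifford_morphism C W n u v.
elim/ten_ind: y => [|y w IHy IHw|a h].
- by rewrite mulr0 tensor_to_hc0 mulr0.
- by rewrite mulrDr !tensor_to_hcD IHy IHw mulrDr.
- by rewrite scal_pure !tensor_to_hc_pure cM cS mulrA.
Qed.

Lemma tensor_to_hc_clifford a y :
  tensor_to_hc ((a ⊗ 1) * y) = hc_clifford a * tensor_to_hc y.
Proof.
have [_ cM _ _] := @hc_clifford_morphism C W n u v.
elim/ten_ind: y => [|y w IHy IHw|a' h].
- by rewrite mulr0 tensor_to_hc0 mulr0.
- by rewrite mulrDr !tensor_to_hcD IHy IHw mulrDr.
have [_ lM _ _] := pure_l_morphism (A := Cl) (B := HS).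
rewrite -[a' ⊗ h]pure1_mul mulrA -lM !pure1_mul.
by rewrite !tensor_to_hc_pure cM mulrA.
Qed.

(** The sign of the super tensor product equals the one from moving the image of [h] past the
    Clifford image. *)
Lemma tensor_to_hc_odd h y : homogeneous true h ->
  (forall i, anticomm (hcc i) (hs_to_hc h)) ->
  tensor_to_hc ((1 ⊗ h) * y) = hs_to_hc h * tensor_to_hc y.
Proof.
have [_ cM cS _] := @hc_clifford_morphism C W n u v.
have [_ hM _ _] := hs_to_hc_morphism.
move=> hh ch; elim/ten_hind: y => [|y w IHy IHw|d e a h' ha _].
- by rewrite mulr0 tensor_to_hc0 mulr0.
- by rewrite mulrDr !tensor_to_hcD IHy IHw mulrDr.
rewrite (mul_pure _ _ hh ha) mul1r andTb !tensor_to_hc_pure cM cS hM.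
rewrite (mulrA (hs_to_hc h)) (hc_clifford_supercomm ch ha).
by rewrite !mulrA.
Qed.

Lemma hs_to_hc_t i : hs_to_hc (hst i) = 'i%:S * (hc_clifford (beta W i) * hcs i).
Proof. exact: hs_to_hc_gen. Qed.

Lemma hs_to_hc_b i : hs_to_hc (hsb i) = ((sqrtC 2 * 'i)^-1)%:S * (hcc i * hcx i).
Proof. exact: hs_to_hc_gen. Qed.

(** The [z] for which this holds for every [y] are closed under sums and products, so generators
    suffice. Multiplicativity of [tensor_to_hc] need not be proved. *)
Lemma tensor_to_hc_linear (z : HC) y :
  tensor_to_hc (hc_to_tensor z * y) = z * tensor_to_hc y.
Proof.
have [pD pM pS _] := hc_to_tensor_morphism.
rewrite -(pcl_repr z); elim: (repr z) y => [g|k|p IHp q IHq|p IHp q IHq] y.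
- case: g => i.
  + rewrite [hc_to_tensor _]hc_to_tensor_x -[clc i ⊗ _]pure1_mul -!mulrA.
    rewrite tensor_to_hcZ tensor_to_hc_clifford tensor_to_hc_odd.
    * rewrite hc_clifford_gen !mulrA -[X in X * _]mulrA; congr (_ * _).
      by rewrite hs_to_hc_b -hcx_b.
    * exact: hsb_odd.
    * by move=> j; rewrite hs_to_hc_b; exact: hc_b_anti.
  + rewrite -[pcl _](@hc_clifford_gen C W n u v) hc_to_tensor_clifford.
    exact: tensor_to_hc_clifford.
  + rewrite [hc_to_tensor _]hc_to_tensor_s -[beta W i ⊗ _]pure1_mul -!mulrA.
    rewrite tensor_to_hcZ tensor_to_hc_clifford tensor_to_hc_odd.
    * rewrite hc_clifford_beta !mulrA -[X in X * _]mulrA; congr (_ * _).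
      by rewrite hs_to_hc_t -hcs_t.
    * exact: hst_odd.
    * by move=> j; rewrite hs_to_hc_t; exact: hc_t_anti.
- by rewrite [hc_to_tensor _]pS tensor_to_hcZ.
- by rewrite pclD pD !mulrDl tensor_to_hcD IHp IHq.
- by rewrite pclM pM -!mulrA IHp IHq.
Qed.

Lemma hc_to_tensorK : cancel hc_to_tensor tensor_to_hc.
Proof.
(* Linearity at [y = 1] reduces the claim to the image of the unit. *)
move=> z; rewrite -[hc_to_tensor z]mulr1 tensor_to_hc_linear.
have [_ _ cS _] := @hc_clifford_morphism C W n u v.
have [_ _ hS _] := hs_to_hc_morphism.
by rewrite tensor_to_hc_pure -!scal1 cS hS !scal1 !mulr1.
Qed.

(** Both sides are morphisms in [h], so generators suffice; there [c_i] or [beta_i] occurs twice and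
    squares to 1. *)
Lemma hc_to_tensor_hs h : hc_to_tensor (hs_to_hc h) = 1 ⊗ h.
Proof.
have m := superalg_morphism_comp hs_to_hc_morphism hc_to_tensor_morphism.
have [_ pM pS _] := hc_to_tensor_morphism.
have [_ lM _ _] := pure_l_morphism (A := Cl) (B := HS).
apply: (presented_morph_uniq (P := spin_hecke_pres W n u v) m pure_r_morphism).
case=> i /=; rewrite [hs_to_hc _]hs_to_hc_gen /= pM pS pM.
- rewrite hc_to_tensor_x -[hcc i]hc_clifford_gen hc_to_tensor_clifford.
  rewrite scalMC mulrA -scalM mulVf ?mulf_neq0 ?sqrtC2_neq0 ?neq0Ci //.
  by rewrite scal1 mul1r -[clc i ⊗ hsb i]pure1_mul mulrA -lM clc_sqr mul1r.
- rewrite hc_to_tensor_s hc_to_tensor_clifford scalMC mulrA -scalM mulrN.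
  rewrite -expr2 sqrCi opprK scal1 mul1r -[beta W i ⊗ hst i]pure1_mul mulrA -lM.
  by rewrite (croot_sqr n_ge clc_sqr clc_anti) mul1r.
Qed.

Lemma tensor_to_hcK : cancel tensor_to_hc hc_to_tensor.
Proof.
have [pD pM pS _] := hc_to_tensor_morphism.
elim/ten_ind => [|y w IHy IHw|a h].
- by rewrite tensor_to_hc0 -scal0 pS scal0.
- by rewrite tensor_to_hcD pD IHy IHw.
by rewrite tensor_to_hc_pure pM hc_to_tensor_clifford hc_to_tensor_hs pure1_mul.
Qed.
End FromTensor.
End Isomorphism.

Theorem theorem4p4 (R : realType) (W : weyl_type) (n : nat) (u v : R[i])
    (hn : match W with TypeD => (4 <= n)%N | TypeB => (2 <= n)%N end) :
  exists Phi : hecke_clifford W n u v ->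
               tensor (clifford R[i] n) (spin_hecke W n u v),
    [/\ superalg_isomorphism Phi,
        forall z : clifford R[i] n, Phi (hc_clifford z) = z ⊗ 1,
        forall i : 'I_n, Phi (hcs i) = (- 'i)%:S * (beta W i ⊗ hst i) &
        forall i : 'I_n, Phi (hcx i) = (sqrtC 2 * 'i)%:S * (clc i ⊗ hsb i)]
    /\
    exists Psi : tensor (clifford R[i] n) (spin_hecke W n u v) ->
                 hecke_clifford W n u v,
      [/\ cancel Phi Psi, cancel Psi Phi,
          forall z : clifford R[i] n, Psi (z ⊗ 1) = hc_clifford z,
          forall i : 'I_n,
            Psi (1 ⊗ hst i) = 'i%:S * (hc_clifford (beta W i) * hcs i) &
          forall i : 'I_n,
            Psi (1 ⊗ hsb i) = ((sqrtC 2 * 'i)^-1)%:S * (hcc i * hcx i)].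
Proof.
have PhiK := @hc_to_tensorK _ W n u v hn; have PsiK := @tensor_to_hcK _ W n u v hn.
have [_ _ cS _] := @hc_clifford_morphism _ W n u v.
have [_ _ hS _] := @hs_to_hc_morphism _ W n u v hn.
have c1 : hc_clifford 1 = 1 :> hecke_clifford W n u v by rewrite -scal1 cS scal1.
have h1 : hs_to_hc 1 = 1 :> hecke_clifford W n u v by rewrite -scal1 hS scal1.
exists (@hc_to_tensor _ W n u v); split.
  split; first (split; [exact: hc_to_tensor_morphism|exact: Bijective PhiK PsiK]).
  - exact: hc_to_tensor_clifford.
  - exact: hc_to_tensor_s.
  - exact: hc_to_tensor_x.
exists (@tensor_to_hc _ W n u v); split=> // [z|i|i].
- by rewrite tensor_to_hc_pure // h1 mulr1.
- by rewrite tensor_to_hc_pure // c1 mul1r hs_to_hc_t.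
- by rewrite tensor_to_hc_pure // c1 mul1r hs_to_hc_b.
Qed.
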